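(* Let $M$ be a proper lightlike isotropic Lagrangian, Lorentzian surface of Type 1 in $\mathbb{C}^2_1$. Then $M$ is locally congruent with a surface of the form $$f(x,v)=\Big(\alpha(x)\,\tfrac{1}{\sqrt2}(-i,-i)+\beta(x)\,\tfrac{1}{\sqrt2}(1,-1)\Big)e^{iv},$$ where $\alpha,\beta$ are real-valued smooth functions of one real variable $x$ with $\alpha'(x)\beta(x)-\alpha(x)\beta'(x)\neq0$ for all $x$.
   Context: $\mathbb{C}^2_1$ is $\mathbb{C}^2$ with the flat metric $\langle z,w\rangle=\mathrm{Re}(-z_1\bar w_1+z_2\bar w_2)$ and complex structure $J$ given by multiplication by $i$. A Lagrangian, Lorentzian surface $M$ is an immersed real surface whose induced metric has signature $(1,1)$ and such that $J$ interchanges the tangent and the normal spaces. Let $h$ be its second fundamental form, $\widetilde\nabla_XY=\nabla_XY+h(X,Y)$. A tangent vector $v\neq 0$ is lightlike if $\langle v,v\rangle=0$. $M$ is lightlike (pseudo-)isotropic if for every lightlike tangent vector $v$ one has $\langle h(v,v),h(v,v)\rangle=0$. It is proper lightlike (pseudo-)isotropic if in addition it has no minimal points, i.e. the trace of $h$ vanishes at no point. A proper lightlike isotropic surface is of Type 1 at a point $p$ if there exists a lightlike $v\in T_pM$ such that $h(v,v)$ and $Jv$ are linearly independent (over $\mathbb{R}$); it is of Type 1 if it is of Type 1 at every point. Locally congruent means: every point of $M$ has a neighbourhood whose image, after applying a holomorphic isometry of $\mathbb{C}^2_1$, coincides with the image of a surface of the given form (with $(x,v)$ ranging over some open subset of $\mathbb{R}^2$).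 *)

(* Defs.v *)
From Stdlib Require Import Reals.
From Coquelicot Require Import Coquelicot.

Open Scope R_scope.

(** * The space C^2_1 *)

(** Vectors of C^2 are added with [plus] and scaled with [scal] (over C); a
    real scalar [a] acts through the coercion [RtoC]. *)
Notation C2 := (C * C)%type.

Definition rscal (a : R) (z : C2) : C2 := scal (RtoC a) z.

Definition metric (z w : C2) : R :=
  Re (- (fst z * Cconj (fst w)) + snd z * Cconj (snd w))%C.

Definition J (z : C2) : C2 := scal Ci z.

Definition lin_indep (u v : C2) : Prop :=
  forall s t : R, plus (rscal s u) (rscal t v) = zero -> s = 0 /\ t = 0.

(** Complex differentiability is [filterdiff] over the field C; the
    differential [L] is then C-linear. *)
Definition holomorphic_isometry (Phi : C2 -> C2) : Prop :=
  (exists Psi : C2 -> C2,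
     (forall z, Psi (Phi z) = z) /\ (forall z, Phi (Psi z) = z)) /\
  (forall z : C2, exists L : C2 -> C2,
     @filterdiff C_AbsRing
       (prod_NormedModule C_AbsRing C_NormedModule C_NormedModule)
       (prod_NormedModule C_AbsRing C_NormedModule C_NormedModule)
       Phi (locally z) L /\
     (forall u v : C2, metric (L u) (L v) = metric u v)).

(** * Smooth maps *)

(** [U] is always open below, so asking for all iterated partial derivatives
    to exist and be continuous at each point of [U] means C^infinity on [U]. *)
Definition smooth_on (U : R * R -> Prop) (g : R * R -> R) : Prop :=
  forall (n : nat) (z : R * R), U z ->
    ex_diff_n (fun x y => g (x, y)) n (fst z) (snd z).

Definition smooth_C2_on (U : R * R -> Prop) (G : R * R -> C2) : Prop :=
  smooth_on U (fun z => Re (fst (G z))) /\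
  smooth_on U (fun z => Im (fst (G z))) /\
  smooth_on U (fun z => Re (snd (G z))) /\
  smooth_on U (fun z => Im (snd (G z))).

Definition smooth1 (g : R -> R) : Prop :=
  forall (n : nat) (x : R), ex_derive_n g n x.

Definition C2_derive (g : R -> C2) (t : R) : C2 :=
  ((Derive (fun s => Re (fst (g s))) t, Derive (fun s => Im (fst (g s))) t),
   (Derive (fun s => Re (snd (g s))) t, Derive (fun s => Im (snd (g s))) t)).

Definition partial1 (G : R * R -> C2) (z : R * R) : C2 :=
  C2_derive (fun s => G (s, snd z)) (fst z).

Definition partial2 (G : R * R -> C2) (z : R * R) : C2 :=
  C2_derive (fun s => G (fst z, s)) (snd z).

(** * Smooth surfaces *)

Definition overlap {M I : Type} (dom : I -> R * R -> Prop)
    (par : I -> R * R -> M) (i j : I) (z : R * R) : Prop :=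
  dom i z /\ exists w, dom j w /\ par j w = par i z.

(** The topology in which every parametrization is a homeomorphism onto an
    open set. *)
Definition atlas_open {M I : Type} (dom : I -> R * R -> Prop)
    (par : I -> R * R -> M) (A : M -> Prop) : Prop :=
  forall i, open (fun z : R * R => dom i z /\ A (par i z)).

(** A smooth 2-manifold, given by injective local parametrizations
    [par i : dom i -> M] with smooth changes of coordinates; Hausdorff and
    second countable. Values of [par i] outside [dom i] are irrelevant. *)
Record surface : Type := Surface {
  point :> Type;
  index : Type;
  dom : index -> R * R -> Prop;
  par : index -> R * R -> point;
  dom_open : forall i, open (dom i);
  par_inj : forall i z w, dom i z -> dom i w -> par i z = par i w -> z = w;
  par_cover : forall p, exists i z, dom i z /\ par i z = p;
  overlap_open : forall i j, open (overlap dom par i j);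
  transition_smooth : forall i j, exists tau : R * R -> R * R,
    smooth_on (overlap dom par i j) (fun z => fst (tau z)) /\
    smooth_on (overlap dom par i j) (fun z => snd (tau z)) /\
    (forall z, overlap dom par i j z ->
       dom j (tau z) /\ par j (tau z) = par i z);
  hausdorff : forall p q : point, p <> q ->
    exists A B : point -> Prop,
      atlas_open dom par A /\ atlas_open dom par B /\ A p /\ B q /\
      (forall r, ~ (A r /\ B r));
  second_countable : exists B : nat -> point -> Prop,
    (forall n, atlas_open dom par (B n)) /\
    (forall A p, atlas_open dom par A -> A p ->
       exists n, B n p /\ (forall q, B n q -> A q))
}.

Definition open_in (M : surface) (A : M -> Prop) : Prop :=
  atlas_open (dom M) (par M) A.

(** * Immersed surfaces in C^2_1 *)

Section ImmersedSurface.
Context {M : surface} (F : M -> C2).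

Definition local_map (i : index M) (z : R * R) : C2 := F (par M i z).

Definition smooth_immersion : Prop :=
  forall i,
    smooth_C2_on (dom M i) (local_map i) /\
    (forall z, dom M i z ->
       lin_indep (partial1 (local_map i) z) (partial2 (local_map i) z)).

(** The tangent vector with coordinates [a], [b] in the parametrization [i]. *)
Definition tangent_vector (i : index M) (z : R * R) (a b : R) : C2 :=
  plus (rscal a (partial1 (local_map i) z))
       (rscal b (partial2 (local_map i) z)).

(** The tangent plane at [p], as a subspace of C^2. *)
Definition tangent (p : M) (v : C2) : Prop :=
  exists i z a b, dom M i z /\ par M i z = p /\ v = tangent_vector i z a b.

Definition normal (p : M) (n : C2) : Prop :=
  forall v, tangent p v -> metric n v = 0.

Definition pseudo_orthonormal_basis (p : M) (e1 e2 : C2) : Prop :=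
  tangent p e1 /\ tangent p e2 /\
  metric e1 e1 = -1 /\ metric e2 e2 = 1 /\ metric e1 e2 = 0.

(** The induced metric has signature (1,1). *)
Definition lorentzian : Prop :=
  forall p : M, exists e1 e2, pseudo_orthonormal_basis p e1 e2.

Definition lagrangian : Prop :=
  forall (p : M) (v : C2),
    (tangent p v <-> normal p (J v)) /\ (normal p v <-> tangent p (J v)).

Definition lightlike (p : M) (v : C2) : Prop :=
  tangent p v /\ v <> zero /\ metric v v = 0.

(** [h] satisfies the Gauss formula: for a tangent vector X with coordinates
    [a], [b] and a smooth tangent vector field Y with coordinate functions
    [c], [d], [h X Y] is the normal part of the flat derivative of Y in the
    direction X. Since the induced metric is nondegenerate, this determines
    [h p] on the tangent plane at [p]; its values on other vectors are
    irrelevant. *)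
Definition second_fundamental_form (h : M -> C2 -> C2 -> C2) : Prop :=
  forall (i : index M) (c d : R * R -> R),
    smooth_on (dom M i) c -> smooth_on (dom M i) d ->
    forall (z : R * R) (a b : R), dom M i z ->
      let p := par M i z in
      let X := tangent_vector i z a b in
      let Y := fun w => tangent_vector i w (c w) (d w) in
      let DXY := plus (rscal a (partial1 Y z)) (rscal b (partial2 Y z)) in
      normal p (h p X (Y z)) /\ tangent p (minus DXY (h p X (Y z))).

Section Isotropy.
Context (h : M -> C2 -> C2 -> C2).

Definition lightlike_isotropic : Prop :=
  forall (p : M) (v : C2), lightlike p v -> metric (h p v v) (h p v v) = 0.

(** The trace with respect to the induced metric is - h(e1,e1) + h(e2,e2);
    it does not depend on the chosen basis. *)
Definition minimal_at (p : M) : Prop :=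
  exists e1 e2, pseudo_orthonormal_basis p e1 e2 /\
    plus (opp (h p e1 e1)) (h p e2 e2) = zero.

Definition proper_lightlike_isotropic : Prop :=
  lightlike_isotropic /\ forall p : M, ~ minimal_at p.

Definition type1_at (p : M) : Prop :=
  exists v, lightlike p v /\ lin_indep (h p v v) (J v).

Definition type1 : Prop := forall p : M, type1_at p.

End Isotropy.
End ImmersedSurface.

(** * The model surfaces *)

Definition exp_i (v : R) : C := (cos v, sin v).

Definition w1 : C2 := rscal (/ sqrt 2) (Copp Ci, Copp Ci).
Definition w2 : C2 := rscal (/ sqrt 2) (RtoC 1, Copp (RtoC 1)).

Definition model_surface (alpha beta : R -> R) (x v : R) : C2 :=
  scal (exp_i v) (plus (rscal (alpha x) w1) (rscal (beta x) w2)).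

(* Main.v *)
Require Import Defs.
From Stdlib Require Import Reals Lra Lia Ranalysis5.
From Coquelicot Require Import Coquelicot.

Open Scope R_scope.

(** In a null frame, isotropy, type 1 and the absence of minimal points leave of the cubic
    form <h(X,Y), JZ> only two coefficients, both nonzero; hence there is exactly one tangent
    field [xi] with <h(X,Y), J xi> = <X,Y>, and it is null. By linear algebra it is smooth,
    and h(X, xi) = JX. The mixed second derivatives of [xi] show that [xi] is parallel, so
    that the flat derivative of [xi] is that of [J F] and [F] differs from [- J xi] by a
    constant [c]. Thus [J (F - c)] is tangent and null. After a translation and a diagonal
    unitary map, write [F = (x w1 + w2) p] with [x] real and [p] complex of positive real
    part, which is possible as [F] is null. Rotating the position vector preserves [x] and
    [|p|] and moves the argument [v] of [p] with unit speed, so [x] and [|p|] depend only on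
    a parameter transverse to [xi], and [F] has the form of the model with [beta = |p|] and
    [alpha = x |p|]. *)

(** * Calculus of smooth functions of two variables *)

(** A null frame is at hand only at a single point, so [xi] is not built from one. Its coordinates
    solve three linear equations in two unknowns; the null frame at each point shows that they are
    solvable and that some 2 by 2 minor is nonzero, and Cramer's rule with that minor gives
    smoothness nearby. The induced connection never appears: all identities come from
    differentiating the vanishing of the Kaehler form and of [<xi, xi>] in the flat space. Adapted
    coordinates would normally be taken from the flow of [xi]; since [x] and [v] are explicit
    functions, the level curves of [x] suffice, and these are graphs found by monotonicity and
    intermediate values. Two demands of the conclusion shape the end: the two images must be equal,
    so a neighbourhood on the surface and a parameter domain have to be matched exactly, and
    [alpha], [beta] must be smooth on all of [R], so the interval labelling the level curves is
    stretched to the whole line. *)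

(** Booleans index the two variables; [true] is the first one. *)
Definition coord (k : bool) (z : R * R) : R := if k then fst z else snd z.

Definition slice (k : bool) (z : R * R) (s : R) : R * R :=
  if k then (s, snd z) else (fst z, s).

Definition pd (k : bool) (g : R * R -> R) (z : R * R) : R :=
  Derive (fun s => g (slice k z s)) (coord k z).

(** One fixed order at a time, so that closure properties can be proved by induction on the
    order. *)
Definition diff_on (U : R * R -> Prop) (n : nat) (g : R * R -> R) : Prop :=
  forall z, U z -> ex_diff_n (fun x y => g (x, y)) n (fst z) (snd z).

Lemma slice_coord k z : slice k z (coord k z) = z.
Proof. now destruct k, z. Qed.

Lemma continuous_slice k z s : continuous (slice k z) s.
Proof.
  apply filterlim_locally. intros eps. exists eps. intros y Hy.
  destruct k; split; simpl; try apply ball_center; exact Hy.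
Qed.

Lemma locally_slice k z (P : R * R -> Prop) :
  locally z P -> locally (coord k z) (fun s => P (slice k z s)).
Proof.
  intros HP. apply (continuous_slice k z (coord k z)).
  now rewrite slice_coord.
Qed.

Lemma continuity_2d_continuous (g : R * R -> R) z :
  continuity_2d_pt (fun x y => g (x, y)) (fst z) (snd z) <-> continuous g z.
Proof.
  rewrite continuity_2d_pt_filterlim. destruct z as [x y]; simpl.
  split; intros H; (eapply filterlim_ext; [| exact H]); now intros [u v].
Qed.

Lemma diff_on_O U g : diff_on U 0 g <-> forall z, U z -> continuous g z.
Proof.
  split; intros H z Hz; specialize (H z Hz).
  - now apply continuity_2d_continuous, H.
  - split; [| trivial]. now apply continuity_2d_continuous.
Qed.

(** Turns the recursion of [ex_diff_n] at a point into one over a region, where partial derivatives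
    are again functions to which an induction hypothesis applies. *)
Lemma diff_on_S U n g :
  diff_on U (S n) g <->
  (forall z, U z -> continuous g z) /\
  (forall k z, U z -> ex_derive (fun s => g (slice k z s)) (coord k z)) /\
  (forall k, diff_on U n (pd k g)).
Proof.
  split.
  - intros H. split; [| split].
    + intros z Hz. apply continuity_2d_continuous, (H z Hz).
    + intros k z Hz. destruct (H z Hz) as (_ & H1 & H2 & _). now destruct k.
    + intros k z Hz. destruct (H z Hz) as (_ & _ & _ & H1 & H2). now destruct k.
  - intros (H0 & H1 & H2) z Hz. split; [now apply continuity_2d_continuous, H0 |].
    split; [exact (H1 true z Hz) |]. split; [exact (H1 false z Hz) |].
    split; [exact (H2 true z Hz) | exact (H2 false z Hz)].
Qed.

Lemma diff_on_pred U n g : diff_on U (S n) g -> diff_on U n g.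
Proof. intros H z Hz. apply (ex_diff_n_m (S n)); [lia | now apply H]. Qed.

Lemma diff_on_ext U n f g : open U -> (forall z, U z -> f z = g z) ->
  diff_on U n f -> diff_on U n g.
Proof.
  intros HU Heq Hf z Hz. apply (ex_diff_n_ext_loc (fun x y => f (x, y))); [| now apply Hf].
  destruct (HU z Hz) as [eps He]. exists eps. intros u v Hu Hv. apply Heq, He.
  now split.
Qed.

Lemma smooth_on_diff U g : smooth_on U g <-> forall n, diff_on U n g.
Proof. split; intros H n z; auto. now apply H. Qed.

Lemma smooth_on_sub (U U' : R * R -> Prop) g :
  (forall z, U' z -> U z) -> smooth_on U g -> smooth_on U' g.
Proof. intros H Hg n z Hz. apply Hg, H, Hz. Qed.

Lemma smooth_on_ext U f g : open U -> (forall z, U z -> f z = g z) ->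
  smooth_on U f -> smooth_on U g.
Proof. rewrite !smooth_on_diff. intros HU H Hf n. eapply diff_on_ext; eauto. Qed.

Lemma smooth_on_continuous U g z : smooth_on U g -> U z -> continuous g z.
Proof. intros H Hz. apply continuity_2d_continuous, (H 0%nat z Hz). Qed.

Lemma smooth_on_ex_derive U g k z : smooth_on U g -> U z ->
  ex_derive (fun s => g (slice k z s)) (coord k z).
Proof.
  rewrite smooth_on_diff. intros H Hz. specialize (H 1%nat). apply diff_on_S in H.
  now apply H.
Qed.

Lemma smooth_on_is_derive U g k z : smooth_on U g -> U z ->
  is_derive (fun s => g (slice k z s)) (coord k z) (pd k g z).
Proof. intros H Hz. now apply Derive_correct, (smooth_on_ex_derive U). Qed.

Lemma smooth_on_pd U g k : smooth_on U g -> smooth_on U (pd k g).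
Proof.
  rewrite !smooth_on_diff. intros H n. specialize (H (S n)).
  apply diff_on_S in H. now apply H.
Qed.

Lemma pd_ext U f g k z : open U -> (forall w, U w -> f w = g w) -> U z ->
  pd k f z = pd k g z.
Proof.
  intros HU H Hz. apply Derive_ext_loc. apply (locally_slice k z (fun w => f w = g w)).
  apply (filter_imp U); auto.
Qed.

Lemma pd_const k c z : pd k (fun _ => c) z = 0.
Proof. exact (Derive_const c (coord k z)). Qed.

Lemma diff_on_const U n c : diff_on U n (fun _ => c).
Proof.
  revert c; induction n as [| n IH]; intros c.
  - apply diff_on_O. intros; apply continuous_const.
  - apply diff_on_S. split; [intros; apply continuous_const | split].
    + intros; apply ex_derive_const.
    + intros k z Hz. apply (ex_diff_n_ext_loc (fun _ _ => 0)); [| exact (IH 0 z Hz)].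
      exists (mkposreal 1 Rlt_0_1). intros u v _ _. symmetry.
      exact (pd_const k c (u, v)).
Qed.

Lemma smooth_on_const U c : smooth_on U (fun _ => c).
Proof. apply smooth_on_diff. intros; apply diff_on_const. Qed.

Lemma smooth_on_fst : smooth_on (fun _ => True) (fun z => fst z).
Proof.
  apply smooth_on_diff. intros [| n].
  - apply diff_on_O. intros; apply continuous_fst.
  - apply diff_on_S. split; [intros; apply continuous_fst | split].
    + intros [] z _; [apply ex_derive_id |].
      exact (ex_derive_const (V := R_NormedModule) (fst z) (snd z)).
    + intros k. apply (diff_on_ext _ _ (fun _ => if k then 1 else 0));
        [apply open_true | | apply diff_on_const].
      intros z _. symmetry.
      destruct k; [exact (Derive_id (fst z)) | exact (Derive_const (fst z) (snd z))].
Qed.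

Section PartialDerivatives.
Context (k : bool) (f g : R * R -> R) (z : R * R).
Hypothesis (Hf : ex_derive (fun s => f (slice k z s)) (coord k z)).
Hypothesis (Hg : ex_derive (fun s => g (slice k z s)) (coord k z)).

Lemma pd_plus : pd k (fun z => f z + g z) z = pd k f z + pd k g z.
Proof. now apply Derive_plus. Qed.

Lemma pd_mult : pd k (fun z => f z * g z) z = pd k f z * g z + f z * pd k g z.
Proof.
  unfold pd.
  rewrite (Derive_mult (fun s => f (slice k z s)) (fun s => g (slice k z s))) by auto.
  now rewrite !slice_coord.
Qed.

Lemma pd_inv : f z <> 0 -> pd k (fun z => / f z) z = - pd k f z * (/ f z * / f z).
Proof.
  intros H. unfold pd.
  rewrite (Derive_inv (fun s => f (slice k z s))); rewrite ?slice_coord; auto.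
  now field.
Qed.

Lemma pd_comp (phi : R -> R) : ex_derive phi (f z) ->
  pd k (fun z => phi (f z)) z = pd k f z * Derive phi (f z).
Proof.
  intros H. unfold pd.
  rewrite (Derive_comp phi (fun s => f (slice k z s))); rewrite ?slice_coord; auto.
Qed.
End PartialDerivatives.

Section Closure.
Context (U : R * R -> Prop) (HU : open U).

Lemma diff_on_plus n f g : diff_on U n f -> diff_on U n g ->
  diff_on U n (fun z => f z + g z).
Proof.
  revert f g; induction n as [| n IH]; intros f g.
  - rewrite !diff_on_O. intros Hf Hg z Hz. apply (continuous_plus f g); auto.
  - rewrite !diff_on_S. intros (Hf & Df & If) (Hg & Dg & Ig). split; [| split].
    + intros z Hz. apply (continuous_plus f g); auto.
    + intros k z Hz. apply (ex_derive_plus (fun s => f (slice k z s))); auto.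
    + intros k. apply (diff_on_ext U n (fun z => pd k f z + pd k g z)); auto.
      intros z Hz. symmetry. apply pd_plus; auto.
Qed.

Lemma diff_on_mult n f g : diff_on U n f -> diff_on U n g ->
  diff_on U n (fun z => f z * g z).
Proof.
  revert f g; induction n as [| n IH]; intros f g.
  - rewrite !diff_on_O. intros Hf Hg z Hz. apply (continuous_mult f g); auto.
  - intros Hf' Hg'. generalize Hf' Hg'.
    apply diff_on_pred in Hf', Hg'.
    rewrite !diff_on_S. intros (Hf & Df & If) (Hg & Dg & Ig). split; [| split].
    + intros z Hz. apply (continuous_mult f g); auto.
    + intros k z Hz. apply (ex_derive_mult (fun s => f (slice k z s))); auto.
    + intros k. apply (diff_on_ext U n (fun z => pd k f z * g z + f z * pd k g z)); auto.
      * intros z Hz. symmetry. apply pd_mult; auto.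
      * apply diff_on_plus; auto.
Qed.

(** The derivative of [phi] is needed only to orders below [n]: for the inverse and the square root
    it is itself an expression in [phi], so induction on the order supplies exactly that. *)
Lemma diff_on_comp (phi : R -> R) (D : R -> Prop) n f :
  (forall z, U z -> D (f z)) ->
  (forall x, D x -> ex_derive phi x) ->
  diff_on U n f ->
  (forall m, (m < n)%nat -> diff_on U m (fun z => Derive phi (f z))) ->
  diff_on U n (fun z => phi (f z)).
Proof.
  intros HD Hphi. destruct n as [| n].
  - rewrite !diff_on_O. intros Hf _ z Hz. apply (continuous_comp f phi); auto.
    apply (@ex_derive_continuous R_AbsRing R_NormedModule); auto.
  - intros Hf' Hc. generalize Hf'. rewrite !diff_on_S. intros (Hf & Df & If).
    split; [| split].
    + intros z Hz. apply (continuous_comp f phi); auto.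
      apply (@ex_derive_continuous R_AbsRing R_NormedModule); auto.
    + intros k z Hz. apply (ex_derive_comp phi (fun s => f (slice k z s))); auto.
      rewrite slice_coord; auto.
    + intros k.
      apply (diff_on_ext U n (fun z => pd k f z * Derive phi (f z))); auto.
      * intros z Hz. symmetry. apply pd_comp; auto.
      * apply diff_on_mult; auto.
Qed.

Lemma diff_on_inv n f : (forall z, U z -> f z <> 0) -> diff_on U n f ->
  diff_on U n (fun z => / f z).
Proof.
  intros Hnz Hf.
  assert (Hd : forall x : R, x <> 0 -> Derive Rinv x = -1 * (/ x * / x)).
  { intros x Hx. rewrite (Derive_inv (fun x => x)); auto using ex_derive_id.
    rewrite Derive_id. now field. }
  revert Hf. induction n as [| n IH]; intros Hf.
  - apply (diff_on_comp Rinv (fun x => x <> 0)); auto; [| lia].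
    intros x Hx. apply (ex_derive_inv (fun x => x)); auto using ex_derive_id.
  - apply (diff_on_comp Rinv (fun x => x <> 0)); auto.
    + intros x Hx. apply (ex_derive_inv (fun x => x)); auto using ex_derive_id.
    + intros m Hm. assert (Hn : diff_on U n (fun z => / f z)) by auto using diff_on_pred.
      apply (diff_on_ext U m (fun z => -1 * (/ f z * / f z))); auto.
      * intros z Hz. symmetry. auto.
      * intros z Hz. apply (ex_diff_n_m n); [lia |].
        revert z Hz. change (diff_on U n (fun z => -1 * (/ f z * / f z))).
        apply diff_on_mult; [apply diff_on_const |]. now apply diff_on_mult.
Qed.

Lemma smooth_on_plus f g : smooth_on U f -> smooth_on U g ->
  smooth_on U (fun z => f z + g z).
Proof. rewrite !smooth_on_diff. intros Hf Hg n. now apply diff_on_plus. Qed.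

Lemma smooth_on_mult f g : smooth_on U f -> smooth_on U g ->
  smooth_on U (fun z => f z * g z).
Proof. rewrite !smooth_on_diff. intros Hf Hg n. now apply diff_on_mult. Qed.

Lemma smooth_on_opp f : smooth_on U f -> smooth_on U (fun z => - f z).
Proof.
  intros Hf. apply (smooth_on_ext U (fun z => -1 * f z)); auto.
  - intros; ring.
  - apply smooth_on_mult; auto. apply smooth_on_const.
Qed.

Lemma smooth_on_minus f g : smooth_on U f -> smooth_on U g ->
  smooth_on U (fun z => f z - g z).
Proof. intros Hf Hg. apply smooth_on_plus; auto. now apply smooth_on_opp. Qed.

Lemma smooth_on_inv f : (forall z, U z -> f z <> 0) -> smooth_on U f ->
  smooth_on U (fun z => / f z).
Proof. rewrite !smooth_on_diff. intros H Hf n. now apply diff_on_inv. Qed.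

Lemma smooth_on_div f g : (forall z, U z -> g z <> 0) ->
  smooth_on U f -> smooth_on U g -> smooth_on U (fun z => f z / g z).
Proof. intros H Hf Hg. apply smooth_on_mult; auto. now apply smooth_on_inv. Qed.

Lemma smooth_on_sqrt f : (forall z, U z -> 0 < f z) -> smooth_on U f ->
  smooth_on U (fun z => sqrt (f z)).
Proof.
  rewrite !smooth_on_diff. intros Hpos Hf n.
  assert (Hd : forall x, 0 < x -> is_derive sqrt x (/ 2 * / sqrt x)).
  { intros x Hx. evar_last.
    - apply (is_derive_sqrt (fun x => x)); [apply @is_derive_id | exact Hx].
    - change (one : R) with 1. field. apply Rgt_not_eq, sqrt_lt_R0, Hx. }
  induction n as [| n IH].
  - apply (diff_on_comp sqrt (fun x => 0 < x)); auto; [| lia].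
    intros x Hx. eexists; auto.
  - apply (diff_on_comp sqrt (fun x => 0 < x)); auto.
    + intros x Hx. eexists; auto.
    + intros m Hm. apply (diff_on_ext U m (fun z => / 2 * / sqrt (f z))); auto.
      * intros z Hz. symmetry. apply is_derive_unique. auto.
      * intros z Hz. apply (ex_diff_n_m n); [lia |].
        revert z Hz. change (diff_on U n (fun z => / 2 * / sqrt (f z))).
        apply diff_on_mult; [apply diff_on_const |]. apply diff_on_inv; auto.
        intros z Hz. apply Rgt_not_eq, sqrt_lt_R0. auto.
Qed.

Lemma smooth_on_atan f : smooth_on U f -> smooth_on U (fun z => atan (f z)).
Proof.
  intros Hf. apply smooth_on_diff. intros n.
  apply (diff_on_comp atan (fun _ => True)); auto.
  - intros x _. eexists; apply is_derive_atan.
  - now apply smooth_on_diff.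
  - intros m _. apply smooth_on_diff.
    apply (smooth_on_ext U (fun z => / (1 + f z * f z))); auto.
    + intros z Hz. symmetry. apply is_derive_unique, is_derive_atan.
    + apply smooth_on_inv.
      * intros z Hz. nra.
      * apply smooth_on_plus; [apply smooth_on_const | now apply smooth_on_mult].
Qed.
End Closure.

(** The induction closes because exchanging the variables turns [pd k] into [pd (negb k)]. *)
Lemma smooth_on_swap U g : smooth_on U g ->
  smooth_on (fun w => U (snd w, fst w)) (fun w => g (snd w, fst w)).
Proof.
  rewrite !smooth_on_diff. intros Hg n. generalize (Hg n). clear Hg. revert g.
  assert (Hc : forall z, continuous (fun w : R * R => (snd w, fst w)) z).
  { intros z. apply filterlim_locally. intros eps. exists eps. now intros y []. }
  induction n as [| n IH]; intros g.
  - rewrite !diff_on_O. intros Hg z Hz.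
    apply (continuous_comp (fun w : R * R => (snd w, fst w)) g); auto.
  - rewrite !diff_on_S. intros (Hg & Dg & Ig). split; [| split].
    + intros z Hz. apply (continuous_comp (fun w : R * R => (snd w, fst w)) g); auto.
    + intros k z Hz. specialize (Dg (negb k) _ Hz). now destruct k.
    + intros k. specialize (Ig (negb k)). apply IH in Ig. now destruct k.
Qed.

(** Functions of one variable are treated as functions of two that ignore the second, so that the
    same closure lemmas produce [alpha] and [beta]. *)
Lemma smooth_on_line U (g : R * R -> R) t0 (phi : R -> R) :
  smooth_on U g -> (forall y, U (phi y, t0)) ->
  (forall y, ex_derive phi y) ->
  smooth_on (fun _ => True) (fun w => Derive phi (fst w)) ->
  smooth_on (fun _ => True) (fun w => g (phi (fst w), t0)).
Proof.
  intros Hg HU Hphi Hphi'. apply smooth_on_diff. intros n.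
  rewrite smooth_on_diff in Hg. generalize (Hg n). clear Hg. revert g.
  assert (Hc : forall w : R * R, continuous (fun w : R * R => (phi (fst w), t0)) w).
  { intros w. apply filterlim_locally. intros eps.
    assert (H : continuous (fun w : R * R => phi (fst w)) w).
    { apply (continuous_comp fst phi); [apply continuous_fst |].
      apply (@ex_derive_continuous R_AbsRing R_NormedModule), Hphi. }
    apply (proj1 (filterlim_locally _ _)) with (eps := eps) in H.
    revert H. apply filter_imp. intros x Hx. split; [exact Hx | apply ball_center]. }
  induction n as [| n IH]; intros g.
  - rewrite !diff_on_O. intros Hg w _.
    apply (continuous_comp (fun w : R * R => (phi (fst w), t0)) g); auto.
  - intros Hg'. generalize Hg'. rewrite !diff_on_S. intros (Hg & Dg & Ig).
    split; [| split].
    + intros w _. apply (continuous_comp (fun w : R * R => (phi (fst w), t0)) g); auto.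
    + intros [] w _; simpl; [| apply ex_derive_const].
      apply (ex_derive_comp (fun s => g (s, t0)) phi); auto.
      exact (Dg true (phi (fst w), t0) (HU _)).
    + intros [].
      * apply (diff_on_ext _ _ (fun w => Derive phi (fst w) * pd true g (phi (fst w), t0))).
        -- apply open_true.
        -- intros w _. symmetry. unfold pd; simpl.
           apply (Derive_comp (fun s => g (s, t0)) phi); auto.
           exact (Dg true (phi (fst w), t0) (HU _)).
        -- apply diff_on_mult; [apply open_true | now apply smooth_on_diff |].
           apply IH, Ig.
      * apply (diff_on_ext _ _ (fun _ => 0)); [apply open_true | | apply diff_on_const].
        intros w _. symmetry. exact (Derive_const (g (phi (fst w), t0)) (snd w)).
Qed.

Lemma smooth1_of_smooth_on (g : R * R -> R) t0 :
  smooth_on (fun _ => True) g -> smooth1 (fun x => g (x, t0)).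
Proof.
  rewrite smooth_on_diff. intros Hg n x. destruct n as [| n]; [exact I |].
  generalize (Hg (S n)). clear Hg.
  revert g x. induction n as [| n IH]; intros g x Hg; apply diff_on_S in Hg;
    destruct Hg as (_ & Dg & Ig).
  - exact (Dg true (x, t0) I).
  - specialize (IH _ x (Ig true)).
    apply (ex_derive_ext (Derive_n (fun x => pd true g (x, t0)) n)); [| exact IH].
    intros t. clear. revert t. induction n as [| n IH]; intros t; [reflexivity |].
    simpl. apply Derive_ext. intros y. apply IH.
Qed.

Lemma pd_comm U g z : open U -> smooth_on U g -> U z ->
  pd true (pd false g) z = pd false (pd true g) z.
Proof.
  intros HU Hg Hz. destruct z as [x y]. unfold pd; simpl.
  apply (Schwarz (fun x y => g (x, y))).
  - destruct (HU _ Hz) as [eps He]. exists eps. intros u v Hu Hv.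
    assert (Huv : U (u, v)) by (apply He; now split).
    split; [exact (smooth_on_ex_derive U g true (u, v) Hg Huv) |].
    split; [exact (smooth_on_ex_derive U g false (u, v) Hg Huv) |].
    split.
    + exact (smooth_on_ex_derive U _ true (u, v) (smooth_on_pd U g false Hg) Huv).
    + exact (smooth_on_ex_derive U _ false (u, v) (smooth_on_pd U g true Hg) Huv).
  - apply (continuity_2d_continuous (pd true (pd false g)) (x, y)).
    apply (smooth_on_continuous U); auto using smooth_on_pd.
  - apply (continuity_2d_continuous (pd false (pd true g)) (x, y)).
    apply (smooth_on_continuous U); auto using smooth_on_pd.
Qed.

(** * Linear algebra of C^2_1 *)

Lemma C2_ext (u v : C2) :
  fst (fst u) = fst (fst v) -> snd (fst u) = snd (fst v) ->
  fst (snd u) = fst (snd v) -> snd (snd u) = snd (snd v) -> u = v.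
Proof. destruct u as [[] []], v as [[] []]; simpl; intros; now subst. Qed.

Lemma metricE u v : metric u v =
  - (fst (fst u) * fst (fst v) + snd (fst u) * snd (fst v))
  + (fst (snd u) * fst (snd v) + snd (snd u) * snd (snd v)).
Proof. destruct u as [[] []], v as [[] []]. unfold metric, Re, Im, Cconj; simpl. ring. Qed.

Ltac c2_ring :=
  intros; apply C2_ext; unfold rscal, J, minus, plus, opp, scal, zero; simpl;
  unfold mult; simpl; ring.

Lemma metric_plus_l u v w : metric (plus u v) w = metric u w + metric v w.
Proof. rewrite !metricE. simpl. ring. Qed.

Lemma metric_rscal_l a u w : metric (rscal a u) w = a * metric u w.
Proof. rewrite !metricE. simpl. ring. Qed.

Lemma metric_opp_l u w : metric (opp u) w = - metric u w.
Proof. rewrite !metricE. simpl. ring. Qed.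

Lemma metric_sym u w : metric u w = metric w u.
Proof. rewrite !metricE. ring. Qed.

Lemma metric_J_l u w : metric (J u) w = - metric u (J w).
Proof. rewrite !metricE. simpl. ring. Qed.

Lemma metric_J_J u w : metric (J u) (J w) = metric u w.
Proof. rewrite !metricE. simpl. ring. Qed.

Lemma metric_J_self u : metric u (J u) = 0.
Proof. rewrite !metricE. simpl. ring. Qed.

Lemma metric_plus_r u v w : metric w (plus u v) = metric w u + metric w v.
Proof. now rewrite metric_sym, metric_plus_l, !(metric_sym w). Qed.

Lemma metric_rscal_r a u w : metric w (rscal a u) = a * metric w u.
Proof. now rewrite metric_sym, metric_rscal_l, (metric_sym w). Qed.

Lemma J_plus u v : J (plus u v) = plus (J u) (J v).
Proof. c2_ring. Qed.

Lemma J_rscal a u : J (rscal a u) = rscal a (J u).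
Proof. c2_ring. Qed.

Lemma metric_minus_l u v w : metric (minus u v) w = metric u w - metric v w.
Proof. unfold minus. rewrite metric_plus_l, metric_opp_l. ring. Qed.

Ltac bilin := rewrite ?J_plus, ?J_rscal;
  repeat rewrite ?metric_minus_l, ?metric_plus_l, ?metric_plus_r, ?metric_opp_l,
    ?metric_rscal_l, ?metric_rscal_r, ?J_plus, ?J_rscal.

(* In complex terms [n] is orthogonal to [a] and [b] for the Hermitian form, and
   the square modulus of the complex determinant of [a], [b] is minus the Gram
   determinant. *)
Lemma orthogonal_frame_eq_0 a b n :
  metric a a * metric b b - metric a b * metric a b <> 0 -> metric a (J b) = 0 ->
  metric n a = 0 -> metric n b = 0 -> metric n (J a) = 0 -> metric n (J b) = 0 ->
  n = zero.
Proof.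
  destruct a as [[a1 a2] [a3 a4]], b as [[b1 b2] [b3 b4]], n as [[n1 n2] [n3 n4]].
  rewrite !metricE; simpl. intros Hg Hw H1 H2 H3 H4.
  set (dr := (a1 * b3 - a2 * b4) - (b1 * a3 - b2 * a4)).
  set (di := (a1 * b4 + a2 * b3) - (b1 * a4 + b2 * a3)).
  assert (Hd : dr * dr + di * di <> 0).
  { intros H0. apply Hg.
    replace 0 with (- (dr * dr + di * di) + 0 * 0) by (rewrite H0; ring).
    rewrite <- Hw. unfold dr, di. ring. }
  (* The two equations are the real and imaginary parts of [(n1 + i n2) (dr - i di) = 0]. *)
  assert (K : forall n1 n2, n1 * dr + n2 * di = 0 -> n2 * dr - n1 * di = 0 ->
    n1 = 0 /\ n2 = 0).
  { intros x y E1 E2. split; apply (Rmult_eq_reg_r (dr * dr + di * di)); auto.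
    - transitivity ((x * dr + y * di) * dr - (y * dr - x * di) * di); [ring |].
      rewrite E1, E2. ring.
    - transitivity ((x * dr + y * di) * di + (y * dr - x * di) * dr); [ring |].
      rewrite E1, E2. ring. }
  set (X1 := - (n1 * a1 + n2 * a2) + (n3 * a3 + n4 * a4)) in *.
  set (X2 := - (n1 * b1 + n2 * b2) + (n3 * b3 + n4 * b4)) in *.
  set (Y1 := - (n1 * (0 * a1 - 1 * a2) + n2 * (0 * a2 + 1 * a1)) +
     (n3 * (0 * a3 - 1 * a4) + n4 * (0 * a4 + 1 * a3))) in *.
  set (Y2 := - (n1 * (0 * b1 - 1 * b2) + n2 * (0 * b2 + 1 * b1)) +
     (n3 * (0 * b3 - 1 * b4) + n4 * (0 * b4 + 1 * b3))) in *.
  destruct (K n1 n2) as [E1 E2].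
  - transitivity (a3 * X2 + a4 * Y2 - b3 * X1 - b4 * Y1);
      [unfold X1, X2, Y1, Y2, dr, di; ring | rewrite H1, H2, H3, H4; ring].
  - transitivity (a3 * Y2 - a4 * X2 - b3 * Y1 + b4 * X1);
      [unfold X1, X2, Y1, Y2, dr, di; ring | rewrite H1, H2, H3, H4; ring].
  - destruct (K n3 n4) as [E3 E4].
    + transitivity (a1 * X2 + a2 * Y2 - b1 * X1 - b2 * Y1);
        [unfold X1, X2, Y1, Y2, dr, di; ring | rewrite H1, H2, H3, H4; ring].
    + transitivity (a1 * Y2 - a2 * X2 - b1 * Y1 + b2 * X1);
        [unfold X1, X2, Y1, Y2, dr, di; ring | rewrite H1, H2, H3, H4; ring].
    + now subst.
Qed.

(** The Gram system gives a combination of [a] and [b] whose difference from [u] is orthogonal to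
    [a], [b], [J a] and [J b], hence zero. This replaces every dimension count for tangent
    planes. *)
Lemma lagrangian_span a b u :
  metric a a * metric b b - metric a b * metric a b <> 0 -> metric a (J b) = 0 ->
  metric u (J a) = 0 -> metric u (J b) = 0 ->
  exists x y, u = plus (rscal x a) (rscal y b).
Proof.
  intros Hg Hab Ha Hb.
  assert (Hba : metric b (J a) = 0) by (rewrite metric_sym, metric_J_l; lra).
  set (d := metric a a * metric b b - metric a b * metric a b) in *.
  set (x := (metric u a * metric b b - metric u b * metric a b) / d).
  set (y := (metric u b * metric a a - metric u a * metric a b) / d).
  exists x, y.
  assert (H : minus u (plus (rscal x a) (rscal y b)) = zero).
  { apply (orthogonal_frame_eq_0 a b); auto; bilin;
      rewrite ?metric_J_self, ?Hab, ?Hba, ?(metric_sym b a).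
    - unfold x, y, d; field; exact Hg.
    - unfold x, y, d; field; exact Hg.
    - rewrite Ha; ring.
    - rewrite Hb; ring. }
  replace u with (plus (minus u (plus (rscal x a) (rscal y b)))
    (plus (rscal x a) (rscal y b))) at 1 by c2_ring.
  rewrite H. apply plus_zero_l.
Qed.

Lemma comb_eq_0 a b x y :
  metric a a * metric b b - metric a b * metric a b <> 0 ->
  metric (plus (rscal x a) (rscal y b)) a = 0 ->
  metric (plus (rscal x a) (rscal y b)) b = 0 -> x = 0 /\ y = 0.
Proof.
  bilin. rewrite (metric_sym b a). intros Hd H1 H2.
  split; apply (Rmult_eq_reg_r (metric a a * metric b b - metric a b * metric a b));
    auto; rewrite Rmult_0_l.
  - transitivity ((x * metric a a + y * metric a b) * metric b b -
      (x * metric a b + y * metric b b) * metric a b); [ring |].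
    rewrite H1, H2; ring.
  - transitivity ((x * metric a b + y * metric b b) * metric a a -
      (x * metric a a + y * metric a b) * metric a b); [ring |].
    rewrite H1, H2; ring.
Qed.

(** * Binary cubic forms *)

(** The symmetric trilinear form of the binary cubic with coefficients [c0], [3 c1], [3 c2],
    [c3]. *)
Definition cubic (c0 c1 c2 c3 : R) (x y u : R * R) : R :=
  c0 * (fst x * fst y * fst u) +
  c1 * (fst x * fst y * snd u + fst x * snd y * fst u + snd x * fst y * fst u) +
  c2 * (fst x * snd y * snd u + snd x * fst y * snd u + snd x * snd y * fst u) +
  c3 * (snd x * snd y * snd u).

Definition quad (e f g : R) (x y : R * R) : R :=
  e * (fst x * fst y) + f * (fst x * snd y + snd x * fst y) + g * (snd x * snd y).

(** Expanding the standard basis in the frame [v], [w] writes [d * d] times each coefficient as a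
    combination of the three given values. *)
Lemma quad_eq_0 e f g v w : fst v * snd w - snd v * fst w <> 0 ->
  quad e f g v v = 0 -> quad e f g v w = 0 -> quad e f g w w = 0 ->
  e = 0 /\ f = 0 /\ g = 0.
Proof.
  unfold quad. destruct v as [v1 v2], w as [w1 w2]; simpl. intros Hd A B C.
  set (d := v1 * w2 - v2 * w1) in *.
  assert (Hd2 : d * d <> 0) by (apply Rmult_integral_contrapositive; auto).
  split; [| split]; apply (Rmult_eq_reg_r (d * d)); auto; rewrite Rmult_0_l.
  - transitivity (w2 * w2 * (e * (v1 * v1) + f * (v1 * v2 + v2 * v1) + g * (v2 * v2))
      - 2 * w2 * v2 * (e * (v1 * w1) + f * (v1 * w2 + v2 * w1) + g * (v2 * w2))
      + v2 * v2 * (e * (w1 * w1) + f * (w1 * w2 + w2 * w1) + g * (w2 * w2)));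
      [unfold d; ring | rewrite A, B, C; ring].
  - transitivity (- w1 * w2 * (e * (v1 * v1) + f * (v1 * v2 + v2 * v1) + g * (v2 * v2))
      + (w1 * v2 + v1 * w2) * (e * (v1 * w1) + f * (v1 * w2 + v2 * w1) + g * (v2 * w2))
      - v1 * v2 * (e * (w1 * w1) + f * (w1 * w2 + w2 * w1) + g * (w2 * w2)));
      [unfold d; ring | rewrite A, B, C; ring].
  - transitivity (w1 * w1 * (e * (v1 * v1) + f * (v1 * v2 + v2 * v1) + g * (v2 * v2))
      - 2 * w1 * v1 * (e * (v1 * w1) + f * (v1 * w2 + v2 * w1) + g * (v2 * w2))
      + v1 * v1 * (e * (w1 * w1) + f * (w1 * w2 + w2 * w1) + g * (w2 * w2)));
      [unfold d; ring | rewrite A, B, C; ring].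
Qed.

(** Contracted with [w], the cubic form takes the value [k] on the pair [v], [w] and vanishes on
    [v], [v] and on [w], [w]; so it is proportional to the quadratic form, and [m / k] is the factor
    that makes them equal. The three equations say just that in coordinates, and a nonzero minor
    makes their solution unique. *)
Lemma cubic_null_solution c0 c1 c2 c3 e f g v w :
  fst v * snd w - snd v * fst w <> 0 ->
  quad e f g v v = 0 -> quad e f g w w = 0 -> quad e f g v w <> 0 ->
  cubic c0 c1 c2 c3 v v w = 0 -> cubic c0 c1 c2 c3 w w w = 0 ->
  cubic c0 c1 c2 c3 v v v <> 0 -> cubic c0 c1 c2 c3 v w w <> 0 ->
  (exists x, x <> (0, 0) /\ quad e f g x x = 0 /\
    c0 * fst x + c1 * snd x = e /\ c1 * fst x + c2 * snd x = f /\
    c2 * fst x + c3 * snd x = g) /\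
  (c0 * c2 - c1 * c1 <> 0 \/ c0 * c3 - c1 * c2 <> 0 \/ c1 * c3 - c2 * c2 <> 0).
Proof.
  intros Hd Qv Qw Qm Cvvw Cwww Cvvv Cvww. split.
  - set (m := quad e f g v w) in *. set (k := cubic c0 c1 c2 c3 v w w) in *.
    exists (m / k * fst w, m / k * snd w). split; [| split].
    + intros E. injection E as E1 E2.
      assert (Hmk : m / k <> 0).
      { intros E0. apply Qm. replace m with (m / k * k) by (field; auto).
        rewrite E0; ring. }
      apply Rmult_integral in E1. apply Rmult_integral in E2. apply Hd.
      destruct E1 as [|E1], E2 as [|E2]; try contradiction. rewrite E1, E2. ring.
    + unfold quad in *; simpl. transitivity (m / k * (m / k) * 0); [| ring].
      rewrite <- Qw. ring.
    + simpl.
      assert (H : c0 * (m / k * fst w) + c1 * (m / k * snd w) - e = 0 /\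
        c1 * (m / k * fst w) + c2 * (m / k * snd w) - f = 0 /\
        c2 * (m / k * fst w) + c3 * (m / k * snd w) - g = 0).
      { apply (quad_eq_0 _ _ _ v w Hd).
        - transitivity (m / k * cubic c0 c1 c2 c3 v v w - quad e f g v v);
            [unfold cubic, quad; simpl; ring | rewrite Cvvw, Qv; ring].
        - transitivity (m / k * cubic c0 c1 c2 c3 v w w - quad e f g v w);
            [unfold cubic, quad; simpl; ring |].
          fold k m. now field.
        - transitivity (m / k * cubic c0 c1 c2 c3 w w w - quad e f g w w);
            [unfold cubic, quad; simpl; ring | rewrite Cwww, Qw; ring]. }
      lra.
  - (* The three minors are the coefficients of the Hessian of the cubic form,
       whose value at [v] is computed in the frame [v], [w]. *)
    destruct (Req_dec (c0 * c2 - c1 * c1) 0) as [H0 | ]; [| now left].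
    destruct (Req_dec (c0 * c3 - c1 * c2) 0) as [H1 | ]; [| now right; left].
    right; right. intros H2.
    apply (Rmult_integral_contrapositive _ _ (conj Cvvv Cvww)).
    transitivity (cubic c0 c1 c2 c3 v v w * cubic c0 c1 c2 c3 v v w +
      (fst v * snd w - snd v * fst w) * (fst v * snd w - snd v * fst w) *
      ((c0 * c2 - c1 * c1) * (fst v * fst v) + (c0 * c3 - c1 * c2) * (fst v * snd v)
       + (c1 * c3 - c2 * c2) * (snd v * snd v))).
    + unfold cubic. ring.
    + rewrite Cvvw, H0, H1, H2. ring.
Qed.

(** * Calculus of vector valued functions *)

Definition vpd (k : bool) (G : R * R -> C2) (z : R * R) : C2 :=
  if k then partial1 G z else partial2 G z.

(** [i] selects the complex component and [j] its real part; vector identities are checked on the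
    four projections. *)
Definition proj (i j : bool) (u : C2) : R :=
  let c := if i then fst u else snd u in if j then fst c else snd c.

Lemma proj_ext u v : (forall i j, proj i j u = proj i j v) -> u = v.
Proof.
  intros H.
  apply C2_ext; [apply (H true true) | apply (H true false) | apply (H false true)
    | apply (H false false)].
Qed.

Lemma proj_plus i j u v : proj i j (plus u v) = proj i j u + proj i j v.
Proof. now destruct i, j. Qed.

Lemma proj_rscal i j a u : proj i j (rscal a u) = a * proj i j u.
Proof. destruct i, j; unfold proj, rscal; simpl; ring. Qed.

Lemma proj_J i j u : proj i j (J u) = (if j then -1 else 1) * proj i (negb j) u.
Proof. destruct i, j; unfold proj, J; simpl; ring. Qed.

Lemma proj_metric u v : metric u v =
  (-1 * (proj true true u * proj true true v) + -1 * (proj true false u * proj true false v))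
  + (proj false true u * proj false true v + proj false false u * proj false false v).
Proof. rewrite metricE. unfold proj. ring. Qed.

Lemma proj_vpd i j k G z : proj i j (vpd k G z) = pd k (fun w => proj i j (G w)) z.
Proof. now destruct i, j, k. Qed.

Lemma smooth_C2_proj U G :
  smooth_C2_on U G <-> forall i j, smooth_on U (fun w => proj i j (G w)).
Proof.
  split.
  - now intros (H1 & H2 & H3 & H4) [] [].
  - intros H. exact (conj (H true true) (conj (H true false)
      (conj (H false true) (H false false)))).
Qed.

Section VectorCalculus.
Context (U : R * R -> Prop) (HU : open U).

Lemma smooth_C2_pd G k : smooth_C2_on U G -> smooth_C2_on U (vpd k G).
Proof.
  rewrite !smooth_C2_proj. intros H i j.
  apply (smooth_on_ext U (pd k (fun w => proj i j (G w)))); auto using smooth_on_pd.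
  intros w _. now rewrite proj_vpd.
Qed.

Lemma smooth_C2_plus Y Z : smooth_C2_on U Y -> smooth_C2_on U Z ->
  smooth_C2_on U (fun w => plus (Y w) (Z w)).
Proof.
  rewrite !smooth_C2_proj. intros HY HZ i j.
  apply (smooth_on_ext U (fun w => proj i j (Y w) + proj i j (Z w))); auto.
  - intros w _. now rewrite proj_plus.
  - now apply smooth_on_plus.
Qed.

Lemma smooth_C2_rscal c Y : smooth_on U c -> smooth_C2_on U Y ->
  smooth_C2_on U (fun w => rscal (c w) (Y w)).
Proof.
  rewrite !smooth_C2_proj. intros Hc HY i j.
  apply (smooth_on_ext U (fun w => c w * proj i j (Y w))); auto.
  - intros w _. now rewrite proj_rscal.
  - now apply smooth_on_mult.
Qed.

Lemma smooth_C2_J Y : smooth_C2_on U Y -> smooth_C2_on U (fun w => J (Y w)).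
Proof.
  rewrite !smooth_C2_proj. intros HY i j.
  apply (smooth_on_ext U (fun w => (if j then -1 else 1) * proj i (negb j) (Y w))); auto.
  - intros w _. now rewrite proj_J.
  - apply smooth_on_mult; auto using smooth_on_const.
Qed.

Lemma smooth_metric Y Z : smooth_C2_on U Y -> smooth_C2_on U Z ->
  smooth_on U (fun w => metric (Y w) (Z w)).
Proof.
  rewrite !smooth_C2_proj. intros HY HZ.
  apply (smooth_on_ext U _ _ HU (fun w _ => eq_sym (proj_metric (Y w) (Z w)))).
  repeat first [ apply smooth_on_plus; [exact HU | |] | apply smooth_on_mult; [exact HU | |]
    | apply smooth_on_const | apply HY | apply HZ ].
Qed.

Section AtPoint.
Context (k : bool) (z : R * R) (Hz : U z).

Lemma pd_plus_on f g : smooth_on U f -> smooth_on U g ->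
  pd k (fun w => f w + g w) z = pd k f z + pd k g z.
Proof. intros Hf Hg. apply pd_plus; now apply (smooth_on_ex_derive U). Qed.

Lemma pd_mult_on f g : smooth_on U f -> smooth_on U g ->
  pd k (fun w => f w * g w) z = pd k f z * g z + f z * pd k g z.
Proof. intros Hf Hg. apply pd_mult; now apply (smooth_on_ex_derive U). Qed.

Lemma vpd_plus Y Z : smooth_C2_on U Y -> smooth_C2_on U Z ->
  vpd k (fun w => plus (Y w) (Z w)) z = plus (vpd k Y z) (vpd k Z z).
Proof.
  rewrite !smooth_C2_proj. intros HY HZ. apply proj_ext. intros i j.
  rewrite proj_plus, !proj_vpd.
  rewrite <- (pd_plus_on (fun w => proj i j (Y w)) (fun w => proj i j (Z w))) by auto.
  apply (pd_ext U); auto. intros w _. apply proj_plus.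
Qed.

Lemma vpd_rscal c Y : smooth_on U c -> smooth_C2_on U Y ->
  vpd k (fun w => rscal (c w) (Y w)) z =
  plus (rscal (pd k c z) (Y z)) (rscal (c z) (vpd k Y z)).
Proof.
  rewrite !smooth_C2_proj. intros Hc HY. apply proj_ext. intros i j.
  rewrite proj_plus, !proj_rscal, !proj_vpd.
  rewrite <- (pd_mult_on c (fun w => proj i j (Y w))) by auto.
  apply (pd_ext U); auto. intros w _. apply proj_rscal.
Qed.

Lemma vpd_J Y : smooth_C2_on U Y -> vpd k (fun w => J (Y w)) z = J (vpd k Y z).
Proof.
  rewrite !smooth_C2_proj. intros HY. apply proj_ext. intros i j.
  rewrite proj_J, !proj_vpd.
  transitivity (pd k (fun w => (if j then -1 else 1) * proj i (negb j) (Y w)) z).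
  - apply (pd_ext U); auto. intros w _. apply proj_J.
  - exact (Derive_scal _ _ _).
Qed.

Lemma pd_metric Y Z : smooth_C2_on U Y -> smooth_C2_on U Z ->
  pd k (fun w => metric (Y w) (Z w)) z =
  metric (vpd k Y z) (Z z) + metric (Y z) (vpd k Z z).
Proof.
  rewrite !smooth_C2_proj. intros HY HZ.
  etransitivity; [exact (pd_ext U _ _ k z HU (fun w _ => proj_metric (Y w) (Z w)) Hz) |].
  rewrite !proj_metric, !proj_vpd.
  assert (M : forall i j, smooth_on U (fun w => proj i j (Y w) * proj i j (Z w))).
  { intros i j. now apply smooth_on_mult. }
  assert (M' : forall i j, smooth_on U (fun w => -1 * (proj i j (Y w) * proj i j (Z w)))).
  { intros i j. apply smooth_on_mult; auto using smooth_on_const. }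
  rewrite (pd_plus_on (fun w => _ + _) (fun w => _ + _)) by (apply smooth_on_plus; auto).
  rewrite (pd_plus_on (fun w => -1 * _) (fun w => -1 * _)) by auto.
  rewrite (pd_plus_on (fun w => _ * _) (fun w => _ * _)) by auto.
  rewrite !(pd_mult_on (fun w => -1) (fun w => _ * _)) by auto using smooth_on_const.
  rewrite !(pd_mult_on (fun w => proj _ _ (Y w)) (fun w => proj _ _ (Z w))) by auto.
  rewrite !pd_const. ring.
Qed.

Lemma vpd_comm G : smooth_C2_on U G ->
  vpd true (vpd false G) z = vpd false (vpd true G) z.
Proof.
  rewrite !smooth_C2_proj. intros HG. apply proj_ext. intros i j. rewrite !proj_vpd.
  transitivity (pd true (pd false (fun w => proj i j (G w))) z).
  - apply (pd_ext U); auto. intros; apply proj_vpd.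
  - rewrite (pd_comm U) by auto.
    symmetry. apply (pd_ext U); auto. intros; apply proj_vpd.
Qed.
End AtPoint.
End VectorCalculus.

(** * Local geometry of the surface *)

(** [J v], [J w] is a null frame of the normal plane, so each coefficient is read off by pairing
    with the other frame vector. *)
Lemma normal_null_frame v w n :
  metric v v = 0 -> metric w w = 0 -> metric v w <> 0 -> metric v (J w) = 0 ->
  metric n v = 0 -> metric n w = 0 ->
  n = plus (rscal (metric n (J w) / metric v w) (J v))
           (rscal (metric n (J v) / metric v w) (J w)).
Proof.
  intros Hv Hw Hm Hvw Hnv Hnw.
  assert (Hwv : metric w (J v) = 0) by (rewrite metric_sym, metric_J_l; lra).
  set (n' := plus _ _).
  assert (H : minus n n' = zero).
  { apply (orthogonal_frame_eq_0 v w); auto; unfold n'; bilin;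
      rewrite ?metric_J_J, ?metric_J_l, ?Hvw, ?Hwv, ?metric_J_self, ?Hv, ?Hw, ?Hnv, ?Hnw,
        ?(metric_sym w v); try ring.
    - intros E. apply Hm. nra.
    - now field.
    - now field. }
  replace n with (plus (minus n n') n') by c2_ring.
  rewrite H. apply plus_zero_l.
Qed.

(** Turns isotropy into the vanishing of a product of two entries of the cubic form. *)
Lemma metric_normal_null_frame v w n :
  metric v v = 0 -> metric w w = 0 -> metric v w <> 0 -> metric v (J w) = 0 ->
  metric n v = 0 -> metric n w = 0 ->
  metric n n * metric v w = 2 * (metric n (J v) * metric n (J w)).
Proof.
  intros Hv Hw Hm Hvw Hnv Hnw.
  pose proof (normal_null_frame v w n Hv Hw Hm Hvw Hnv Hnw) as E.
  rewrite E at 2. bilin. field. exact Hm.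
Qed.

(** * The cubic form of the immersion in a chart *)

Section Chart.
Context {M : surface} {F : M -> C2} {h : M -> C2 -> C2 -> C2}.
Context (immersed : smooth_immersion F) (lor : lorentzian F) (lag : lagrangian F).
Context (sff : second_fundamental_form F h).
Context (isotropic : proper_lightlike_isotropic F h) (typ : type1 F h).
Context (i : index M).

Let D := dom M i.
Let G := local_map F i.
Let A := vpd true G.
Let B := vpd false G.

Let HD : open D.
Proof. apply dom_open. Qed.

Let HG : smooth_C2_on D G.
Proof. apply immersed. Qed.

Definition tvec (z : R * R) (x : R * R) : C2 := tangent_vector F i z (fst x) (snd x).

Lemma tangent_tvec z x : D z -> tangent F (par M i z) (tvec z x).
Proof. intros Hz. now exists i, z, (fst x), (snd x). Qed.

Lemma tvecE z x : tvec z x = plus (rscal (fst x) (A z)) (rscal (snd x) (B z)).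
Proof. reflexivity. Qed.

Lemma tangent_partial k z : D z -> tangent F (par M i z) (vpd k G z).
Proof.
  intros Hz. replace (vpd k G z) with (tvec z (if k then (1, 0) else (0, 1))).
  - now apply tangent_tvec.
  - rewrite tvecE. destruct k; unfold A, B; c2_ring.
Qed.

Lemma tangent_kaehler p u v : tangent F p u -> tangent F p v -> metric u (J v) = 0.
Proof. intros Hu Hv. rewrite metric_sym. apply (lag p v); auto. Qed.

Lemma frame_independent z : D z -> lin_indep (A z) (B z).
Proof. intros Hz. now apply (immersed i). Qed.

Lemma gram_neq_0 z : D z ->
  metric (A z) (A z) * metric (B z) (B z) - metric (A z) (B z) * metric (A z) (B z) <> 0.
Proof.
  intros Hz. set (p := par M i z).
  destruct (lor p) as (e1 & e2 & T1 & T2 & E1 & E2 & E3).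
  assert (S : forall k, exists x y, vpd k G z = plus (rscal x e1) (rscal y e2)).
  { intros k. apply lagrangian_span.
    - rewrite E1, E2, E3. lra.
    - now apply (tangent_kaehler p).
    - apply (tangent_kaehler p); auto. now apply tangent_partial.
    - apply (tangent_kaehler p); auto. now apply tangent_partial. }
  destruct (S true) as (a & b & HA), (S false) as (c & d & HB).
  pose proof (frame_independent z Hz) as Hind. unfold A, B in *.
  rewrite HA, HB in *. clear HA HB S.
  bilin. rewrite (metric_sym e2 e1), E1, E2, E3. intros Hg.
  (* The Gram determinant is [- (a d - b c)^2]. If it vanished, independence of the partial
     derivatives would make [a] and [b] zero, and with them [A z]. *)
  assert (Hdet : a * d - b * c = 0) by nra.
  destruct (Hind d (- b)) as [Hd Hb].
  { transitivity (plus (rscal (a * d - b * c) e1) (rscal 0 e2)); [c2_ring |].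
    rewrite Hdet. c2_ring. }
  destruct (Hind c (- a)) as [Hc Ha].
  { transitivity (plus (rscal 0 e1) (rscal (- (a * d - b * c)) e2)); [c2_ring |].
    rewrite Hdet. c2_ring. }
  destruct (Hind 1 0) as [H1 _]; [| lra].
  replace a with 0 by lra. replace b with 0 by lra. c2_ring.
Qed.

Lemma frame_kaehler j k z : D z -> metric (vpd j G z) (J (vpd k G z)) = 0.
Proof. intros Hz. apply (tangent_kaehler (par M i z)); now apply tangent_partial. Qed.

(** A tangent vector may come from another chart; the Lagrangian condition, rather than a change of
    coordinates, expresses it in this one. *)
Lemma tangent_coordinates z u : D z -> tangent F (par M i z) u -> exists x, u = tvec z x.
Proof.
  intros Hz Hu. destruct (lagrangian_span (A z) (B z) u) as (x & y & E).
  - now apply gram_neq_0.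
  - now apply frame_kaehler.
  - apply (tangent_kaehler (par M i z)); auto. now apply tangent_partial.
  - apply (tangent_kaehler (par M i z)); auto. now apply tangent_partial.
  - now exists (x, y).
Qed.

(** These are the values of [<h(X,Y), JZ>] on the coordinate fields: the tangential part of a second
    derivative is orthogonal to [J] of a tangent vector. *)
Definition form (j k l : bool) (z : R * R) : R :=
  metric (vpd j (vpd k G) z) (J (vpd l G z)).

(** Differentiate the vanishing Kaehler form [<d_k G, J d_l G>] in the direction [j] and move [J]
    across. *)
Lemma form_sym j k l z : D z -> form j k l z = form j l k z.
Proof.
  intros Hz. unfold form.
  assert (H : pd j (fun w => metric (vpd k G w) (J (vpd l G w))) z = 0).
  { rewrite (pd_ext D _ (fun _ => 0)); auto.
    - apply pd_const.
    - intros w Hw. now apply frame_kaehler. }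
  rewrite (pd_metric D HD j z Hz (vpd k G) (fun w => J (vpd l G w))) in H;
    auto using smooth_C2_J, smooth_C2_pd.
  rewrite (vpd_J D HD j z Hz) in H by auto using smooth_C2_pd.
  rewrite (metric_sym (vpd k G z)), metric_J_l in H. lra.
Qed.

Lemma form_comm j k l z : D z -> form j k l z = form k j l z.
Proof.
  intros Hz. unfold form. destruct j, k; auto; now rewrite (vpd_comm D HD z Hz G HG).
Qed.

Definition cform z := cubic (form true true true z) (form true true false z)
  (form true false false z) (form false false false z).

Definition gform z := quad (metric (A z) (A z)) (metric (A z) (B z)) (metric (B z) (B z)).

Lemma metric_tvec z x y : metric (tvec z x) (tvec z y) = gform z x y.
Proof. unfold gform, quad. rewrite !tvecE. bilin. rewrite (metric_sym (B z) (A z)). ring. Qed.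

Lemma sff_normal z x y : D z ->
  normal F (par M i z) (h (par M i z) (tvec z x) (tvec z y)).
Proof.
  intros Hz.
  destruct (sff i (fun _ => fst y) (fun _ => snd y) (smooth_on_const _ _)
    (smooth_on_const _ _) z (fst x) (snd x) Hz) as [H _].
  exact H.
Qed.

(** The second argument is extended by the field with constant coordinates, whose derivative
    contains only second derivatives of the immersion. *)
Lemma sff_cform z x y u : D z ->
  metric (h (par M i z) (tvec z x) (tvec z y)) (J (tvec z u)) = cform z x y u.
Proof.
  intros Hz.
  destruct (sff i (fun _ => fst y) (fun _ => snd y) (smooth_on_const _ _)
    (smooth_on_const _ _) z (fst x) (snd x) Hz) as [_ H].
  apply (tangent_kaehler _ _ (tvec z u)) in H; [| now apply tangent_tvec].
  rewrite metric_minus_l in H.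
  apply Rminus_diag_uniq_sym in H. etransitivity; [exact H |]. clear H.
  assert (K : forall k, vpd k (fun w => plus (rscal (fst y) (A w)) (rscal (snd y) (B w))) z
    = plus (rscal (fst y) (vpd k A z)) (rscal (snd y) (vpd k B z))).
  { intros k. rewrite (vpd_plus D HD k z Hz (fun w => rscal (fst y) (A w)))
      by (apply smooth_C2_rscal; auto using smooth_on_const; now apply smooth_C2_pd).
    rewrite !(vpd_rscal D HD k z Hz (fun _ => _))
      by (auto using smooth_on_const; now apply smooth_C2_pd).
    rewrite !pd_const. c2_ring. }
  change (metric (plus
    (rscal (fst x) (vpd true (fun w => plus (rscal (fst y) (A w)) (rscal (snd y) (B w))) z))
    (rscal (snd x) (vpd false (fun w => plus (rscal (fst y) (A w)) (rscal (snd y) (B w))) z)))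
    (J (tvec z u)) = cform z x y u).
  rewrite !K, tvecE. bilin.
  change (metric (vpd true A z) (J (A z))) with (form true true true z).
  change (metric (vpd true A z) (J (B z))) with (form true true false z).
  change (metric (vpd true B z) (J (A z))) with (form true false true z).
  change (metric (vpd true B z) (J (B z))) with (form true false false z).
  change (metric (vpd false A z) (J (A z))) with (form false true true z).
  change (metric (vpd false A z) (J (B z))) with (form false true false z).
  change (metric (vpd false B z) (J (A z))) with (form false false true z).
  change (metric (vpd false B z) (J (B z))) with (form false false false z).
  rewrite (form_sym true false true), !(form_comm false true), (form_sym false false true),
    (form_comm false true) by exact Hz.
  rewrite (form_sym true false true) by exact Hz.
  unfold cform, cubic. ring.
Qed.

(** Write C for the cubic form and [v], [w] for a null frame with [v] given by type 1. Isotropy at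
    [v] kills C(v,v,w) because type 1 keeps C(v,v,v) nonzero. The trace is a multiple of [h(v,w)],
    so absence of minimal points keeps C(v,w,w) nonzero, and isotropy at [w] then kills C(w,w,w). *)
Lemma null_solution z : D z ->
  let c0 := form true true true z in let c1 := form true true false z in
  let c2 := form true false false z in let c3 := form false false false z in
  (exists x, x <> (0, 0) /\ gform z x x = 0 /\
    c0 * fst x + c1 * snd x = metric (A z) (A z) /\
    c1 * fst x + c2 * snd x = metric (A z) (B z) /\
    c2 * fst x + c3 * snd x = metric (B z) (B z)) /\
  (c0 * c2 - c1 * c1 <> 0 \/ c0 * c3 - c1 * c2 <> 0 \/ c1 * c3 - c2 * c2 <> 0).
Proof.
  intros Hz c0 c1 c2 c3. set (p := par M i z).
  destruct (typ p) as (v & (Tv & Nv & Qv) & Hind).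
  destruct (lor p) as (e1 & e2 & T1 & T2 & E1 & E2 & E3).
  destruct (tangent_coordinates z e1 Hz T1) as [x1 X1].
  destruct (tangent_coordinates z e2 Hz T2) as [x2 X2].
  destruct (lagrangian_span e1 e2 v) as (a & b & Ev).
  { rewrite E1, E2, E3; lra. }
  { now apply (tangent_kaehler p). }
  { now apply (tangent_kaehler p). }
  { now apply (tangent_kaehler p). }
  (* The reflection of [v] in the line of [e1] spans the other null line. *)
  set (w := plus (rscal a e1) (rscal (- b) e2)).
  assert (Hab : b * b = a * a).
  { rewrite Ev in Qv. revert Qv. bilin. rewrite (metric_sym e2 e1), E1, E2, E3. lra. }
  assert (Ha : a <> 0).
  { intros Ha. assert (b = 0) by nra. apply Nv. rewrite Ev, Ha, H. c2_ring. }
  assert (Hb : b <> 0) by nra.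
  assert (Qw : metric w w = 0).
  { unfold w. bilin. rewrite (metric_sym e2 e1), E1, E2, E3. lra. }
  assert (Qm : metric v w = -2 * (a * a)).
  { rewrite Ev. unfold w. bilin. rewrite (metric_sym e2 e1), E1, E2, E3. lra. }
  assert (Hm : metric v w <> 0) by nra.
  set (x := (a * fst x1 + b * fst x2, a * snd x1 + b * snd x2)).
  set (y := (a * fst x1 - b * fst x2, a * snd x1 - b * snd x2)).
  assert (Vx : v = tvec z x).
  { rewrite Ev, X1, X2, !tvecE. unfold x. simpl fst; simpl snd. c2_ring. }
  assert (Wy : w = tvec z y).
  { unfold w. rewrite X1, X2, !tvecE. unfold y. simpl fst; simpl snd. c2_ring. }
  assert (Tw : tangent F p w) by (rewrite Wy; now apply tangent_tvec).
  assert (Hvw : metric v (J w) = 0) by now apply (tangent_kaehler p).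
  assert (Hwv : metric w (J v) = 0) by now apply (tangent_kaehler p).
  assert (N : forall x y, normal F p (h p (tvec z x) (tvec z y)))
    by (intros; now apply sff_normal).
  assert (Lw : lightlike F p w).
  { split; [exact Tw | split; auto]. intros E0. apply Hm. rewrite E0, metricE. simpl. ring. }
  destruct isotropic as [iso proper].
  assert (Iv : metric (h p v v) (h p v v) = 0) by (apply iso; now split).
  assert (Iw : metric (h p w w) (h p w w) = 0) by now apply iso.
  assert (Nvv : normal F p (h p v v)) by (rewrite Vx; apply N).
  assert (Nww : normal F p (h p w w)) by (rewrite Wy; apply N).
  (* Otherwise only the [J v] term of the null frame expansion survives, and [h(v,v)] is a multiple
     of [J v]. *)
  assert (Jvvv : metric (h p v v) (J v) <> 0).
  { intros E0. destruct (Hind 1 (- (metric (h p v v) (J w) / metric v w))) as [H1 _];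
      [| lra].
    rewrite (normal_null_frame v w (h p v v) Qv Qw Hm Hvw (Nvv v Tv) (Nvv w Tw)) at 1.
    rewrite E0. set (l := metric _ _ / _). unfold Rdiv. rewrite Rmult_0_l. c2_ring. }
  assert (Jvvw : metric (h p v v) (J w) = 0).
  { pose proof (metric_normal_null_frame v w (h p v v) Qv Qw Hm Hvw (Nvv v Tv) (Nvv w Tw)).
    rewrite Iv in H. nra. }
  assert (Jw0 : metric (h p w w) (J v) * metric (h p w w) (J w) = 0).
  { pose proof (metric_normal_null_frame v w (h p w w) Qv Qw Hm Hvw (Nww v Tv) (Nww w Tw)).
    rewrite Iw in H. lra. }
  rewrite Vx in Jvvv, Jvvw, Jw0.
  rewrite Wy in Jvvw, Jw0.
  unfold p in Jvvv, Jvvw, Jw0.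
  rewrite !sff_cform in Jvvv, Jvvw, Jw0 by exact Hz.
  (* As [b * b = a * a], the trace times [a * a] is [- h(v,w)]. Its pairing with [J v] vanishes by
     [Jvvw], so a zero of C(w,w,v) would make the point minimal. *)
  assert (Jvww : cform z y y x <> 0).
  { intros E0. apply (proper p). exists e1, e2. split; [now repeat split |].
    assert (N1 : normal F p (h p e1 e1)) by (rewrite X1; apply N).
    assert (N2 : normal F p (h p e2 e2)) by (rewrite X2; apply N).
    assert (Hmm : metric v v * metric w w - metric v w * metric v w <> 0).
    { rewrite Qv, Qw. nra. }
    assert (K : forall u, a * a * (- cform z x1 x1 u + cform z x2 x2 u) = - cform z x y u).
    { intros u.
      transitivity (- (a * a) * cform z x1 x1 u + b * b * cform z x2 x2 u);
        [rewrite Hab; ring |].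
      unfold cform, cubic, x, y; simpl. ring. }
    apply (orthogonal_frame_eq_0 v w); auto; rewrite metric_plus_l, metric_opp_l.
    - rewrite (N1 v Tv), (N2 v Tv). ring.
    - rewrite (N1 w Tw), (N2 w Tw). ring.
    - rewrite Vx, X1, X2. unfold p. rewrite !sff_cform by exact Hz.
      apply (Rmult_eq_reg_l (a * a)); [| nra].
      rewrite K. transitivity (- cform z x x y); [unfold cform, cubic; ring |].
      rewrite Jvvw. ring.
    - rewrite Wy, X1, X2. unfold p. rewrite !sff_cform by exact Hz.
      apply (Rmult_eq_reg_l (a * a)); [| nra].
      rewrite K. transitivity (- cform z y y x); [unfold cform, cubic; ring |].
      rewrite E0. ring. }
  apply (cubic_null_solution c0 c1 c2 c3 _ _ _ x y).
  - intros Hdet. apply Hm.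
    assert (Hg : metric v v * metric w w - metric v w * metric v w = 0).
    { rewrite Vx, Wy, !metric_tvec. unfold gform, quad.
      set (e := metric (A z) (A z)). set (f := metric (A z) (B z)).
      set (g := metric (B z) (B z)).
      transitivity ((fst x * snd y - snd x * fst y) * (fst x * snd y - snd x * fst y) *
        (e * g - f * f)); [ring | rewrite Hdet; ring]. }
    rewrite Qv, Qw in Hg. nra.
  - fold (gform z). now rewrite <- metric_tvec, <- Vx.
  - fold (gform z). now rewrite <- metric_tvec, <- Wy.
  - fold (gform z). now rewrite <- metric_tvec, <- Wy, <- Vx.
  - exact Jvvw.
  - fold (cform z). destruct (Rmult_integral _ _ Jw0) as [| E0]; [contradiction |].
    now rewrite sff_cform in E0.
  - exact Jvvv.
  - intros E0. apply Jvww. rewrite <- E0. unfold cform, cubic. fold c0 c1 c2 c3. ring.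
Qed.
End Chart.

(** * Smooth dependence of solutions, null lines, locally constant functions *)

Lemma open_preimage {T : UniformSpace} (D : R * R -> Prop) (f : R * R -> T) P :
  open D -> (forall z, D z -> continuous f z) -> open P ->
  open (fun z => D z /\ P (f z)).
Proof.
  intros HD Hf HP z [Hz Hp]. apply filter_and; [now apply HD |].
  apply (Hf z Hz). now apply HP.
Qed.

(** Solutions are already known to exist at each point; what is gained is that they agree with
    smooth functions, so the conclusion speaks about arbitrary solutions [y1], [y2]. *)
Lemma cramer_smooth D (a1 b1 r1 a2 b2 r2 : R * R -> R) z0 :
  open D -> D z0 ->
  smooth_on D a1 -> smooth_on D b1 -> smooth_on D r1 ->
  smooth_on D a2 -> smooth_on D b2 -> smooth_on D r2 ->
  a1 z0 * b2 z0 - b1 z0 * a2 z0 <> 0 ->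
  exists (U : R * R -> Prop) (x1 x2 : R * R -> R),
    open U /\ U z0 /\ (forall z, U z -> D z) /\ smooth_on U x1 /\ smooth_on U x2 /\
    forall z, U z -> forall y1 y2 : R, a1 z * y1 + b1 z * y2 = r1 z ->
      a2 z * y1 + b2 z * y2 = r2 z -> y1 = x1 z /\ y2 = x2 z.
Proof.
  intros HD Hz0 S1 S2 S3 S4 S5 S6 Hdet.
  set (det := fun z => a1 z * b2 z - b1 z * a2 z).
  assert (Sdet : smooth_on D det).
  { apply smooth_on_minus; auto; now apply smooth_on_mult. }
  set (U := fun z => D z /\ det z <> 0).
  assert (HU : open U).
  { apply (open_preimage D det (fun t => t <> 0)); auto.
    - intros z Hz. now apply (smooth_on_continuous D).
    - apply open_neq. }
  assert (Hsub : forall z, U z -> D z) by now intros z [].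
  exists U, (fun z => (r1 z * b2 z - b1 z * r2 z) / det z),
    (fun z => (a1 z * r2 z - r1 z * a2 z) / det z).
  split; [exact HU | split; [now split | split; [exact Hsub |]]].
  split; [| split].
  - apply smooth_on_div; auto; [now intros z [] | | now apply (smooth_on_sub D)].
    apply (smooth_on_sub D); auto. apply smooth_on_minus; auto; now apply smooth_on_mult.
  - apply smooth_on_div; auto; [now intros z [] | | now apply (smooth_on_sub D)].
    apply (smooth_on_sub D); auto. apply smooth_on_minus; auto; now apply smooth_on_mult.
  - intros z [_ Hd] y1 y2 <- <-. unfold det in *. split; field; exact Hd.
Qed.

(** In a nondegenerate plane a null line is its own orthogonal complement: the determinant of [u],
    [x] squared, times [e g - f^2], is the Gram determinant of [u] and [x]. *)
Lemma null_multiple e f g x u : e * g - f * f <> 0 -> x <> (0, 0) ->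
  quad e f g x x = 0 -> quad e f g u x = 0 ->
  exists t, u = (t * fst x, t * snd x).
Proof.
  destruct x as [x1 x2], u as [u1 u2]; unfold quad; simpl. intros Hd Hx Qx Qu.
  assert (H : u1 * x2 - u2 * x1 = 0).
  { assert (H2 : (u1 * x2 - u2 * x1) * (u1 * x2 - u2 * x1) * (e * g - f * f) = 0).
    { transitivity ((e * (u1 * u1) + f * (u1 * u2 + u2 * u1) + g * (u2 * u2)) *
        (e * (x1 * x1) + f * (x1 * x2 + x2 * x1) + g * (x2 * x2)) -
        (e * (u1 * x1) + f * (u1 * x2 + u2 * x1) + g * (u2 * x2)) *
        (e * (u1 * x1) + f * (u1 * x2 + u2 * x1) + g * (u2 * x2))); [ring |].
      rewrite Qx, Qu. ring. }
    apply Rmult_integral in H2. destruct H2 as [H2 |]; [| contradiction].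
    now apply Rmult_integral in H2; destruct H2. }
  destruct (Req_dec x1 0) as [-> | H1].
  - destruct (Req_dec x2 0) as [-> | H2]; [easy |].
    exists (u2 / x2). f_equal; [| now field].
    apply (Rmult_eq_reg_r x2); auto. lra.
  - exists (u1 / x1). f_equal; [now field |].
    apply (Rmult_eq_reg_r x1); auto.
    transitivity (u1 * x2); [lra | now field].
Qed.

Lemma open_ball_R (x eps : R) : open (ball x eps).
Proof.
  intros y Hy. assert (He : 0 < eps - Rabs (y - x)).
  { unfold ball in Hy; simpl in Hy; unfold AbsRing_ball, abs, minus, plus, opp in Hy;
      simpl in Hy. fold (y - x) in Hy. lra. }
  exists (mkposreal _ He). intros t Ht. revert Hy Ht.
  unfold ball; simpl; unfold AbsRing_ball, abs, minus, plus, opp; simpl.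
  fold (y - x) (t - y) (t - x). unfold Rabs. repeat destruct Rcase_abs; lra.
Qed.

Lemma open_ball_R2 (z0 : R * R) (eps : R) : open (ball z0 eps).
Proof.
  apply (open_and (fun z => ball (fst z0) eps (fst z)) (fun z => ball (snd z0) eps (snd z))).
  - apply (open_comp fst); [intros; apply continuous_fst | apply open_ball_R].
  - apply (open_comp snd); [intros; apply continuous_snd | apply open_ball_R].
Qed.

(** Balls of the product are squares, so two coordinate segments inside the ball join any point to
    the center. *)
Lemma constant_on_ball (f : R * R -> R) z0 (eps : posreal) :
  (forall k z, ball z0 eps z -> is_derive (fun s => f (slice k z s)) (coord k z) 0) ->
  forall z, ball z0 eps z -> f z = f z0.
Proof.
  intros Hf [x y] [Hx Hy]. destruct z0 as [x0 y0]; simpl in *.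
  assert (L : forall (g : R -> R) a b,
    (forall t, Rmin a b <= t <= Rmax a b -> is_derive g t 0) -> g a = g b).
  { intros g a b Hg. destruct (MVT_gen g a b (fun _ => 0)) as (c & _ & E).
    - intros t Ht. apply Hg. lra.
    - intros t Ht. apply continuity_pt_filterlim.
      apply (@ex_derive_continuous R_AbsRing R_NormedModule). eexists. now apply Hg.
    - lra. }
  assert (Hb : forall a b t, ball a eps b -> Rmin b a <= t <= Rmax b a -> ball a eps t).
  { intros a b t Hab Ht. unfold ball in *; simpl in *; unfold AbsRing_ball in *; simpl in *.
    unfold abs, minus, plus, opp in *; simpl in *.
    revert Hab Ht. unfold Rmin, Rmax, Rabs. repeat destruct Rle_dec; repeat destruct Rcase_abs;
      lra. }
  transitivity (f (x0, y)).
  - apply (L (fun s => f (s, y))). intros t Ht. apply (Hf true (t, y)).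
    split; simpl; [now apply (Hb x0 x) | exact Hy].
  - apply (L (fun s => f (x0, s))). intros t Ht. apply (Hf false (x0, t)).
    split; simpl; [apply ball_center | now apply (Hb y0 y)].
Qed.

(** * The smooth null field and the center of the surface *)

Section Center.
Context {M : surface} {F : M -> C2} {h : M -> C2 -> C2 -> C2}.
Context (immersed : smooth_immersion F) (lor : lorentzian F) (lag : lagrangian F).
Context (sff : second_fundamental_form F h).
Context (isotropic : proper_lightlike_isotropic F h) (typ : type1 F h).
Context (i : index M).

Let D := dom M i.
Let G := local_map F i.

Let HD : open D.
Proof. apply dom_open. Qed.

Let HG : smooth_C2_on D G.
Proof. apply immersed. Qed.

Let g (j k : bool) (z : R * R) := metric (vpd j G z) (vpd k G z).

(** The minor that is nonzero at [z0] decides which two equations are solved. By uniqueness the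
    smooth solution is the one known pointwise, and so inherits the third equation, nullity and
    nonvanishing. *)
Lemma null_solution_smooth z0 : D z0 ->
  exists (U : R * R -> Prop) (x1 x2 : R * R -> R),
    open U /\ U z0 /\ (forall z, U z -> D z) /\ smooth_on U x1 /\ smooth_on U x2 /\
    forall z, U z -> (x1 z, x2 z) <> (0, 0) /\
      quad (g true true z) (g true false z) (g false false z)
        (x1 z, x2 z) (x1 z, x2 z) = 0 /\
      forall j k, @form _ F i true j k z * x1 z + @form _ F i false j k z * x2 z = g j k z.
Proof.
  intros Hz0.
  set (c0 := @form _ F i true true true). set (c1 := @form _ F i true true false).
  set (c2 := @form _ F i true false false). set (c3 := @form _ F i false false false).
  assert (Sc : forall j k l, smooth_on D (@form _ F i j k l)).
  { intros j k l.
    apply (smooth_metric D HD (vpd j (vpd k G)) (fun z => J (vpd l G z)));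
      auto using smooth_C2_pd, smooth_C2_J. }
  assert (Sg : forall j k, smooth_on D (g j k)).
  { intros j k. apply (smooth_metric D HD (vpd j G) (vpd k G)); auto using smooth_C2_pd. }
  assert (Hsol : forall z, D z -> exists x1 x2, (x1, x2) <> (0, 0) /\
    quad (g true true z) (g true false z) (g false false z) (x1, x2) (x1, x2) = 0 /\
    c0 z * x1 + c1 z * x2 = g true true z /\ c1 z * x1 + c2 z * x2 = g true false z /\
    c2 z * x1 + c3 z * x2 = g false false z).
  { intros z Hz.
    destruct (null_solution immersed lor lag sff isotropic typ i z Hz)
      as [([x1 x2] & Hx) _]. now exists x1, x2. }
  assert (Hred : exists (U : R * R -> Prop) (x1 x2 : R * R -> R),
    open U /\ U z0 /\ (forall z, U z -> D z) /\ smooth_on U x1 /\ smooth_on U x2 /\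
    forall z, U z -> forall y1 y2 : R, c0 z * y1 + c1 z * y2 = g true true z ->
      c1 z * y1 + c2 z * y2 = g true false z ->
      c2 z * y1 + c3 z * y2 = g false false z -> y1 = x1 z /\ y2 = x2 z).
  { destruct (null_solution immersed lor lag sff isotropic typ i z0 Hz0) as [_ Hm].
    fold c0 c1 c2 c3 in Hm. destruct Hm as [Hm | [Hm | Hm]].
    - destruct (cramer_smooth D c0 c1 (g true true) c1 c2 (g true false) z0)
        as (U & x1 & x2 & H1 & H2 & H3 & H4 & H5 & H6); unfold c0, c1, c2; auto.
      exists U, x1, x2. repeat (split; auto); now apply (H6 z H).
    - destruct (cramer_smooth D c0 c1 (g true true) c2 c3 (g false false) z0)
        as (U & x1 & x2 & H1 & H2 & H3 & H4 & H5 & H6); unfold c0, c1, c2, c3; auto.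
      exists U, x1, x2. repeat (split; auto); now apply (H6 z H).
    - destruct (cramer_smooth D c1 c2 (g true false) c2 c3 (g false false) z0)
        as (U & x1 & x2 & H1 & H2 & H3 & H4 & H5 & H6); unfold c1, c2, c3; auto.
      exists U, x1, x2. repeat (split; auto); now apply (H6 z H). }
  destruct Hred as (U & x1 & x2 & H1 & H2 & H3 & H4 & H5 & H6).
  exists U, x1, x2. repeat (split; [assumption |]). intros z Hz.
  destruct (Hsol z (H3 z Hz)) as (y1 & y2 & Hy & Hq & E1 & E2 & E3).
  destruct (H6 z Hz y1 y2 E1 E2 E3) as [-> ->].
  split; [exact Hy | split; [exact Hq |]].
  assert (Fs := form_sym immersed lag i). assert (Fc := form_comm immersed i).
  assert (Dz := H3 z Hz). unfold c0, c1, c2, c3 in *.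
  intros [] [].
  - rewrite <- E1. rewrite (Fc false true true), (Fs true false true) by auto. reflexivity.
  - rewrite <- E2. rewrite (Fc false true false) by auto. reflexivity.
  - transitivity (g true false z); [| apply metric_sym]. rewrite <- E2.
    rewrite (Fs true false true), (Fs false false true), (Fc false true false) by auto.
    reflexivity.
  - exact E3.
Qed.

(** The null field [xi] with [h X xi = J X] is parallel: its covariant derivative
    is [theta X * xi] for a 1-form [theta], and equality of the mixed second
    derivatives of [xi] forces [theta] to vanish. Hence [xi - J G] is constant. *)
Lemma center_exists z0 : D z0 ->
  exists (U : R * R -> Prop) (c : C2),
    open U /\ U z0 /\ (forall z, U z -> D z) /\
    forall z, U z -> exists x : R * R, x <> (0, 0) /\
      J (minus (G z) c) = plus (rscal (fst x) (vpd true G z)) (rscal (snd x) (vpd false G z)) /\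
      metric (minus (G z) c) (minus (G z) c) = 0.
Proof.
  intros Hz0.
  destruct (null_solution_smooth z0 Hz0) as (U & x1 & x2 & HU & U0 & Hsub & S1 & S2 & Hx).
  set (A := vpd true G). set (B := vpd false G).
  assert (SG : forall k, smooth_C2_on U (vpd k G)).
  { intros k. apply smooth_C2_proj. intros i' j'.
    apply (smooth_on_sub D); auto. apply smooth_C2_proj. now apply smooth_C2_pd. }
  assert (SG0 : smooth_C2_on U G).
  { apply smooth_C2_proj. intros i' j'. apply (smooth_on_sub D); auto.
    now apply smooth_C2_proj. }
  set (xi := fun z => plus (rscal (x1 z) (A z)) (rscal (x2 z) (B z))).
  assert (Sxi : smooth_C2_on U xi).
  { apply smooth_C2_plus; auto; apply smooth_C2_rscal; auto; apply SG. }
  (* The covariant derivative of [xi]: the subtracted [J d_k G] is the normal part of the flat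
     derivative, by the equations for [x1] and [x2]. *)
  set (P := fun k z => plus (vpd k xi z) (rscal (-1) (J (vpd k G z)))).
  assert (SP : forall k, smooth_C2_on U (P k)).
  { intros k. apply smooth_C2_plus; auto; [now apply smooth_C2_pd |].
    apply smooth_C2_rscal; auto using smooth_on_const, smooth_C2_J. }
  assert (Hgram : forall z, U z -> g true true z * g false false z -
    g true false z * g true false z <> 0).
  { intros z Hz. exact (gram_neq_0 immersed lor lag i z (Hsub z Hz)). }
  assert (Hk : forall j k z, U z -> metric (vpd j G z) (J (vpd k G z)) = 0).
  { intros j k z Hz. exact (frame_kaehler lag i j k z (Hsub z Hz)). }
  assert (Dxi : forall k z, U z -> vpd k xi z =
    plus (plus (rscal (pd k x1 z) (A z)) (rscal (x1 z) (vpd k A z)))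
         (plus (rscal (pd k x2 z) (B z)) (rscal (x2 z) (vpd k B z)))).
  { intros k z Hz. unfold xi.
    rewrite (vpd_plus U HU k z Hz (fun z => rscal (x1 z) (A z)))
      by (apply smooth_C2_rscal; auto; apply SG).
    now rewrite !(vpd_rscal U HU k z Hz) by (auto; apply SG). }
  assert (PJ : forall k l z, U z -> metric (P k z) (J (vpd l G z)) = 0).
  { intros k l z Hz. pose proof (Hsub z Hz : dom M i z) as Dz. unfold P.
    rewrite Dxi by auto. bilin. rewrite metric_J_J.
    rewrite (Hk true l z Hz : metric (A z) (J (vpd l G z)) = 0).
    rewrite (Hk false l z Hz : metric (B z) (J (vpd l G z)) = 0).
    change (metric (vpd k A z) (J (vpd l G z))) with (@form _ F i k true l z).
    change (metric (vpd k B z) (J (vpd l G z))) with (@form _ F i k false l z).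
    rewrite (form_comm immersed i k true), (form_comm immersed i k false) by auto.
    change (metric (vpd k G z) (vpd l G z)) with (g k l z).
    destruct (Hx z Hz) as (_ & _ & E). rewrite <- (E k l). ring. }
  assert (Nxi : forall z, U z -> metric (xi z) (xi z) = 0).
  { intros z Hz. destruct (Hx z Hz) as (_ & Q & _). rewrite <- Q.
    unfold xi, quad, A, B, g. bilin. rewrite (metric_sym (vpd false G z)). simpl. ring. }
  assert (Pxi : forall k z, U z -> metric (P k z) (xi z) = 0).
  { intros k z Hz.
    assert (E : pd k (fun z => metric (xi z) (xi z)) z = 0).
    { rewrite (pd_ext U _ (fun _ => 0)); auto. apply pd_const. }
    rewrite (pd_metric U HU k z Hz) in E by auto.
    rewrite (metric_sym (xi z)) in E.
    unfold P. rewrite metric_plus_l, metric_rscal_l, metric_J_l.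
    assert (E2 : metric (vpd k G z) (J (xi z)) = 0).
    { unfold xi, A, B. bilin. rewrite !Hk by auto. ring. }
    rewrite E2. lra. }
  assert (Pmul : forall k z, U z -> exists t, P k z = rscal t (xi z)).
  { intros k z Hz.
    destruct (lagrangian_span (A z) (B z) (P k z)) as (a & b & E).
    - now apply Hgram.
    - now apply Hk.
    - now apply PJ.
    - now apply PJ.
    - destruct (Hx z Hz) as (Nx & Q & _).
      destruct (null_multiple _ _ _ (x1 z, x2 z) (a, b) (Hgram z Hz) Nx Q) as [t Ht].
      + rewrite <- (Pxi k z Hz), E. unfold xi, quad, g, A, B. bilin.
        rewrite (metric_sym (vpd false G z) (vpd true G z)). simpl. ring.
      + exists t. simpl in Ht. injection Ht as -> ->. rewrite E. unfold xi. c2_ring. }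
  (* Differentiate [PJ]. The remaining term pairs [t * xi] with [J] of a second derivative, and
     contracting the cubic form with [xi] returns the metric. *)
  assert (PD : forall m k l z t, U z -> P k z = rscal t (xi z) ->
    metric (vpd m (P k) z) (J (vpd l G z)) = t * g m l z).
  { intros m k l z t Hz Ht. pose proof (Hsub z Hz : dom M i z) as Dz.
    assert (E : pd m (fun z => metric (P k z) (J (vpd l G z))) z = 0).
    { rewrite (pd_ext U _ (fun _ => 0)); auto. apply pd_const. }
    rewrite (pd_metric U HU m z Hz (P k) (fun z => J (vpd l G z))) in E
      by auto using smooth_C2_J.
    rewrite (vpd_J U HU m z Hz) in E by auto.
    rewrite Ht in E. unfold xi, A, B in E.
    rewrite metric_rscal_l, metric_plus_l, !metric_rscal_l in E.
    rewrite (metric_sym (vpd true G z) (J (vpd m (vpd l G) z))), metric_J_l in E.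
    rewrite (metric_sym (vpd false G z) (J (vpd m (vpd l G) z))), metric_J_l in E.
    change (metric (vpd m (vpd l G) z) (J (vpd true G z))) with (@form _ F i m l true z) in E.
    change (metric (vpd m (vpd l G) z) (J (vpd false G z))) with (@form _ F i m l false z) in E.
    rewrite (form_sym immersed lag i m l true), (form_sym immersed lag i m l false),
      (form_comm immersed i m true), (form_comm immersed i m false) in E by auto.
    destruct (Hx z Hz) as (_ & _ & Eg). rewrite <- (Eg m l). lra. }
  assert (Pcomm : forall z, U z -> vpd false (P true) z = vpd true (P false) z).
  { intros z Hz. unfold P.
    rewrite !(vpd_plus U HU _ z Hz (vpd _ xi)) by
      auto using smooth_C2_pd, smooth_C2_rscal, smooth_on_const, smooth_C2_J.
    rewrite !(vpd_rscal U HU _ z Hz (fun _ => -1)) by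
      auto using smooth_on_const, smooth_C2_J.
    rewrite !(vpd_J U HU _ z Hz) by auto.
    rewrite (vpd_comm U HU z Hz xi), (vpd_comm U HU z Hz G), !pd_const by auto.
    c2_ring. }
  assert (P0 : forall k z, U z -> P k z = zero).
  { intros k z Hz. destruct (Pmul true z Hz) as [t1 T1], (Pmul false z Hz) as [t2 T2].
    (* So [t1 * B - t2 * A] is orthogonal to the tangent plane, and nondegeneracy gives
       [t1 = t2 = 0]. *)
    assert (E : forall l, t1 * g false l z = t2 * g true l z).
    { intros l. rewrite <- (PD false true l z t1 Hz T1), <- (PD true false l z t2 Hz T2).
      now rewrite Pcomm. }
    destruct (comb_eq_0 (A z) (B z) (- t2) t1 (Hgram z Hz)) as [E1 E2].
    - bilin. specialize (E true). unfold g in E. fold A B in E. lra.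
    - bilin. specialize (E false). unfold g in E. fold A B in E. lra.
    - destruct k; [rewrite T1, E2 | rewrite T2; replace t2 with 0 by lra]; c2_ring. }
  destruct (HU z0 U0) as [eps Heps].
  set (Z := fun z => plus (xi z) (rscal (-1) (J (G z)))).
  assert (SZ : smooth_C2_on U Z).
  { apply smooth_C2_plus; auto. apply smooth_C2_rscal; auto using smooth_on_const, smooth_C2_J. }
  assert (DZ : forall k z, U z -> vpd k Z z = zero).
  { intros k z Hz. rewrite <- (P0 k z Hz). unfold Z, P.
    rewrite (vpd_plus U HU _ z Hz xi) by
      auto using smooth_C2_rscal, smooth_on_const, smooth_C2_J.
    rewrite (vpd_rscal U HU _ z Hz (fun _ => -1)) by auto using smooth_on_const, smooth_C2_J.
    rewrite (vpd_J U HU _ z Hz), pd_const by auto. c2_ring. }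
  assert (CZ : forall z, ball z0 eps z -> Z z = Z z0).
  { intros z Hz. apply proj_ext. intros i' j'.
    apply (constant_on_ball (fun z => proj i' j' (Z z)) z0 eps); auto.
    intros k w Hw. apply Heps in Hw.
    replace 0 with (proj i' j' (vpd k Z w)) by (rewrite DZ by auto; now destruct i', j').
    rewrite proj_vpd. apply (smooth_on_is_derive U (fun z => proj i' j' (Z z))); auto.
    now apply smooth_C2_proj. }
  (* [J (G - c) = xi] means [J c = - Z], which is solved by [c = J Z]. *)
  exists (ball z0 eps), (J (Z z0)).
  split; [apply open_ball_R2 | split; [apply ball_center |]].
  split; [intros z Hz; apply Hsub, Heps, Hz |].
  intros z Hz. specialize (CZ z Hz). apply Heps in Hz.
  destruct (Hx z Hz) as (Nx & _ & _).
  exists (x1 z, x2 z). split; [exact Nx |].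
  assert (E : J (minus (G z) (J (Z z0))) = xi z).
  { transitivity (plus (J (G z)) (Z z0)); [c2_ring |]. rewrite <- CZ. unfold Z. c2_ring. }
  split; [exact E |].
  rewrite <- metric_J_J, E. now apply Nxi.
Qed.
End Center.

(** * Straightening of level curves *)

Lemma smooth_differentiable U f z : open U -> smooth_on U f -> U z ->
  differentiable_pt_lim (fun x y => f (x, y)) (fst z) (snd z) (pd true f z) (pd false f z).
Proof.
  intros HU Hf Hz. apply filterdiff_differentiable_pt_lim. destruct z as [x y]; simpl.
  apply (is_derive_filterdiff (fun x y => f (x, y)) x y
    (fun x y => pd true f (x, y)) (pd false f (x, y))).
  - specialize (HU _ Hz). revert HU. apply filter_imp. intros [u v] Huv.
    apply (smooth_on_is_derive U f true (u, v) Hf Huv).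
  - apply (smooth_on_is_derive U f false (x, y) Hf Hz).
  - apply (continuous_ext (pd true f)); [now intros [] |].
    apply (smooth_on_continuous U); auto. now apply smooth_on_pd.
Qed.

Lemma smooth_derive_along U f (p : R -> R) t l : open U -> smooth_on U f -> U (p t, t) ->
  derivable_pt_lim p t l ->
  derivable_pt_lim (fun s => f (p s, s)) t (pd true f (p t, t) * l + pd false f (p t, t)).
Proof.
  intros HU Hf Hz Hp.
  rewrite <- (Rmult_1_r (pd false f (p t, t))).
  apply (derivable_pt_lim_comp_2d (fun x y => f (x, y)) p (fun s => s)); auto.
  - exact (smooth_differentiable U f (p t, t) HU Hf Hz).
  - apply derivable_pt_lim_id.
Qed.

Lemma ball_R2 (z0 z : R * R) e :
  ball z0 e z <-> Rabs (fst z - fst z0) < e /\ Rabs (snd z - snd z0) < e.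
Proof. reflexivity. Qed.

(** The [sig] type allows the zero to be chosen as a function of a parameter. *)
Lemma IVT_open (f : R -> R) a b : a < b ->
  (forall t, a <= t <= b -> continuous f t) -> f a < 0 < f b ->
  {c | a < c < b /\ f c = 0}.
Proof.
  intros Hab Hf [Ha Hb]. destruct (IVT_interv f a b) as (c & Hc & E); auto.
  - intros t Ht. apply continuity_pt_filterlim. now apply Hf.
  - exists c. split; [| exact E].
    destruct Hc as [[H1 | <-] [H2 | ->]]; split; auto; lra.
Qed.

(** * Level curves as graphs, by monotonicity in the first variable *)

Section Level.
Context (U : R * R -> Prop) (HU : open U) (x : R * R -> R) (Sx : smooth_on U x).
Context (s0 t0 e : R) (HB : forall z, ball (s0, t0) e z -> U z /\ 0 < pd true x z).

Let continuous_x k z : ball (s0, t0) e z -> continuous (fun s => x (slice k z s)) (coord k z).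
Proof.
  intros Hz. apply (@ex_derive_continuous R_AbsRing R_NormedModule).
  apply (smooth_on_ex_derive U); auto. now apply HB.
Qed.

Lemma level_increasing t s s' : Rabs (t - t0) < e -> s0 - e < s -> s' < s0 + e ->
  s < s' -> x (s, t) < x (s', t).
Proof.
  intros Ht H1 H2 H. apply (incr_function_le (fun s => x (s, t)) s s'
    (fun s => pd true x (s, t))); simpl; try lra.
  - intros y Hy1 Hy2. simpl in Hy1, Hy2. apply (smooth_on_is_derive U x true (y, t) Sx).
    apply HB. apply ball_R2; simpl.
    split; [apply Rabs_def1; lra | exact Ht].
  - intros y Hy1 Hy2. simpl in Hy1, Hy2. apply HB. apply ball_R2; simpl.
    split; [apply Rabs_def1; lra | exact Ht].
Qed.

Lemma level_bracket a : 0 < a < e ->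
  exists d, 0 < d < e /\ forall t c, Rabs (t - t0) < d -> Rabs (c - x (s0, t0)) < d ->
    x (s0 - a, t) < c < x (s0 + a, t).
Proof.
  intros Ha.
  assert (Hm : x (s0 - a, t0) < x (s0, t0) < x (s0 + a, t0)).
  { split; apply level_increasing; try lra; rewrite Rminus_diag, Rabs_R0; lra. }
  (* Half of the smaller gap: the shift of [c] and the variation of the end values in [t] may each
     use up one half. *)
  set (m := Rmin (x (s0, t0) - x (s0 - a, t0)) (x (s0 + a, t0) - x (s0, t0)) / 2).
  assert (Hm0 : 0 < m).
  { unfold m, Rmin. destruct Rle_dec; lra. }
  assert (C : forall s, Rabs (s - s0) < e -> exists d : posreal,
    forall t, Rabs (t - t0) < d -> Rabs (x (s, t) - x (s, t0)) < m).
  { intros s Hs.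
    assert (Hc : continuous (fun t => x (s, t)) t0).
    { apply (continuous_x false (s, t0)). apply ball_R2; simpl.
      rewrite (Rminus_diag t0), Rabs_R0. lra. }
    apply (proj1 (filterlim_locally _ _)) with (eps := mkposreal m Hm0) in Hc.
    exact Hc. }
  destruct (C (s0 - a)) as [d1 D1].
  { replace (s0 - a - s0) with (- a) by ring. rewrite Rabs_Ropp, Rabs_pos_eq; lra. }
  destruct (C (s0 + a)) as [d2 D2].
  { replace (s0 + a - s0) with a by ring. rewrite Rabs_pos_eq; lra. }
  exists (Rmin (Rmin d1 d2) (Rmin m (e / 2))). split.
  - split; [| apply Rle_lt_trans with (e / 2); [| lra];
      eapply Rle_trans; [apply Rmin_r | apply Rmin_r]].
    destruct d1, d2; simpl. repeat apply Rmin_pos; auto; lra.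
  - intros t c Ht Hc.
    assert (T1 : Rabs (t - t0) < d1).
    { eapply Rlt_le_trans; [exact Ht |]. eapply Rle_trans; [apply Rmin_l | apply Rmin_l]. }
    assert (T2 : Rabs (t - t0) < d2).
    { eapply Rlt_le_trans; [exact Ht |]. eapply Rle_trans; [apply Rmin_l | apply Rmin_r]. }
    assert (T3 : Rabs (c - x (s0, t0)) < m).
    { eapply Rlt_le_trans; [exact Hc |]. eapply Rle_trans; [apply Rmin_r | apply Rmin_l]. }
    specialize (D1 t T1). specialize (D2 t T2).
    apply Rabs_def2 in D1. apply Rabs_def2 in D2. apply Rabs_def2 in T3.
    assert (M1 : 2 * m <= x (s0, t0) - x (s0 - a, t0)).
    { unfold m. pose proof (Rmin_l (x (s0, t0) - x (s0 - a, t0)) (x (s0 + a, t0) - x (s0, t0))).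
      lra. }
    assert (M2 : 2 * m <= x (s0 + a, t0) - x (s0, t0)).
    { unfold m. pose proof (Rmin_r (x (s0, t0) - x (s0 - a, t0)) (x (s0 + a, t0) - x (s0, t0))).
      lra. }
    lra.
Qed.

Lemma level_curve a d c : 0 < a < e -> 0 < d < e ->
  (forall t, Rabs (t - t0) < d -> x (s0 - a, t) < c < x (s0 + a, t)) ->
  exists p : R -> R, forall t, Rabs (t - t0) < d ->
    Rabs (p t - s0) < a /\ x (p t, t) = c /\
    derivable_pt_lim p t (- (pd false x (p t, t) / pd true x (p t, t))).
Proof.
  intros Ha Hd Hc.
  assert (Hin : forall s t, Rabs (s - s0) <= a -> Rabs (t - t0) < d -> ball (s0, t0) e (s, t)).
  { intros s t Hs Ht. apply ball_R2. simpl. lra. }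
  (* Outside the interval around [t0] the curve takes the default value [s0]. *)
  assert (Hp : forall t, {s | Rabs (t - t0) < d -> Rabs (s - s0) < a /\ x (s, t) = c}).
  { intros t. destruct (Rlt_dec (Rabs (t - t0)) d) as [Ht | Ht]; [| now exists s0].
    destruct (IVT_open (fun s => x (s, t) - c) (s0 - a) (s0 + a)) as (s & Hs & E).
    - lra.
    - intros s Hs. apply (continuous_minus (fun s => x (s, t)) (fun _ => c)).
      + apply (continuous_x true (s, t)). apply Hin; [| exact Ht]. apply Rabs_le. lra.
      + apply continuous_const.
    - specialize (Hc t Ht). lra.
    - exists s. intros _. split; [apply Rabs_def1; lra | lra]. }
  exists (fun t => proj1_sig (Hp t)). set (p := fun t => proj1_sig (Hp t)).
  assert (Hps : forall t, Rabs (t - t0) < d -> Rabs (p t - s0) < a /\ x (p t, t) = c).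
  { intros t. exact (proj2_sig (Hp t)). }
  intros t1 Ht1. fold (p t1). destruct (Hps t1 Ht1) as [Hs1 E1].
  split; [exact Hs1 | split; [exact E1 |]].
  assert (Hz1 : ball (s0, t0) e (p t1, t1)) by (apply Hin; auto; lra).
  destruct (HB _ Hz1) as [Hz1U Hpos].
  set (xs := pd true x (p t1, t1)) in *. set (xt := pd false x (p t1, t1)).
  (* Continuity of [p]: at time [t1] the values of [x] at [p t1 - r'] and [p t1 + r'] lie on either
     side of [c]; they still do at nearby times, and monotonicity traps [p t] between these two
     points. *)
  assert (Hcont : forall r, 0 < r -> exists q : posreal, forall t, Rabs (t - t1) < q ->
    Rabs (t - t0) < d /\ Rabs (p t - p t1) <= r).
  { intros r Hr. apply Rabs_def2 in Hs1.
    set (q1 := d - Rabs (t1 - t0)). assert (Hq1 : 0 < q1) by (unfold q1; lra).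
    assert (Hq1' : forall t, Rabs (t - t1) < q1 -> Rabs (t - t0) < d).
    { intros t Ht. unfold q1 in Ht. replace (t - t0) with ((t - t1) + (t1 - t0)) by ring.
      eapply Rle_lt_trans; [apply Rabs_triang | lra]. }
    set (r' := Rmin r (Rmin (a - (p t1 - s0)) (a + (p t1 - s0)) / 2)).
    assert (Hr' : 0 < r' /\ r' <= r /\ r' < a - (p t1 - s0) /\ r' < a + (p t1 - s0)).
    { unfold r', Rmin. repeat destruct Rle_dec; lra. }
    destruct Hr' as (R0 & R1 & R2 & R3).
    assert (T : forall s, Rabs (s - s0) < a -> x (s, t1) <> c -> exists q : posreal,
      forall t, Rabs (t - t1) < q -> Rabs (x (s, t) - x (s, t1)) < Rabs (c - x (s, t1))).
    { intros s Hs Hne.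
      assert (Hm : 0 < Rabs (c - x (s, t1))) by (apply Rabs_pos_lt; lra).
      assert (Hcs : continuous (fun t => x (s, t)) t1).
      { apply (continuous_x false (s, t1)). apply Hin; auto. lra. }
      apply (proj1 (filterlim_locally _ _)) with (eps := mkposreal _ Hm) in Hcs.
      exact Hcs. }
    assert (L1 : x (p t1 - r', t1) < c).
    { rewrite <- E1. apply level_increasing; lra. }
    assert (L2 : c < x (p t1 + r', t1)).
    { rewrite <- E1. apply level_increasing; lra. }
    destruct (T (p t1 - r')) as [q2 Q2]; [apply Rabs_def1; lra | lra |].
    destruct (T (p t1 + r')) as [q3 Q3]; [apply Rabs_def1; lra | lra |].
    assert (Hq : 0 < Rmin q1 (Rmin q2 q3)).
    { destruct q2, q3; simpl. repeat apply Rmin_pos; auto. }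
    exists (mkposreal _ Hq). simpl. intros t Ht.
    assert (Ht1' : Rabs (t - t1) < q1) by (eapply Rlt_le_trans; [exact Ht | apply Rmin_l]).
    assert (Ht2 : Rabs (t - t1) < q2).
    { eapply Rlt_le_trans; [exact Ht |]. eapply Rle_trans; [apply Rmin_r | apply Rmin_l]. }
    assert (Ht3 : Rabs (t - t1) < q3).
    { eapply Rlt_le_trans; [exact Ht |]. eapply Rle_trans; [apply Rmin_r | apply Rmin_r]. }
    specialize (Hq1' t Ht1'). split; [exact Hq1' |].
    specialize (Q2 t Ht2). specialize (Q3 t Ht3).
    rewrite (Rabs_pos_eq (c - _)) in Q2 by lra.
    rewrite (Rabs_left1 (c - _)) in Q3 by lra.
    apply Rabs_def2 in Q2. apply Rabs_def2 in Q3.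
    destruct (Hps t Hq1') as [Hst Et]. apply Rabs_def2 in Hst.
    apply Rabs_le. split.
    - destruct (Rle_lt_dec (- r) (p t - p t1)) as [| Hlt]; [assumption | exfalso].
      assert (x (p t, t) < x (p t1 - r', t)) by (apply level_increasing; lra). lra.
    - destruct (Rle_lt_dec (p t - p t1) r) as [| Hlt]; [assumption | exfalso].
      assert (x (p t1 + r', t) < x (p t, t)) by (apply level_increasing; lra). lra. }
  intros eps Heps.
  pose proof (smooth_differentiable U x (p t1, t1) HU Sx Hz1U) as Hdiff.
  fold xs xt in Hdiff. simpl in Hdiff.
  (* A Lipschitz constant for [p] at [t1]: with error factor [r <= xs / 2], half of [xs * |ds|]
     absorbs the error in [ds]. The second bound on [r] then makes [r * (|ds| + |k|)] at most
     [eps * xs / 2 * |k|]. *)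
  set (K := 2 * (Rabs xt + xs) / xs).
  assert (HK : 0 < K).
  { unfold K. apply Rdiv_lt_0_compat; auto. pose proof (Rabs_pos xt). lra. }
  set (r := Rmin (xs / 2) (eps * xs / (2 * (K + 1)))).
  assert (Hr : 0 < r).
  { unfold r. apply Rmin_pos; [lra |].
    apply Rdiv_lt_0_compat; [now apply Rmult_lt_0_compat | lra]. }
  assert (Hr1 : r <= xs / 2) by apply Rmin_l.
  assert (Hr2 : r * (K + 1) <= eps * xs / 2).
  { apply Rle_trans with (eps * xs / (2 * (K + 1)) * (K + 1)).
    - apply Rmult_le_compat_r; [lra | apply Rmin_r].
    - right; field; lra. }
  destruct (Hdiff (mkposreal r Hr)) as [q Hq]. simpl in Hq.
  destruct (Hcont (q / 2)) as [q' Hq']; [destruct q; simpl; lra |].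
  assert (Hqq : 0 < Rmin q q') by (destruct q, q'; apply Rmin_pos; auto).
  exists (mkposreal _ Hqq). simpl. intros k Hk Hkq.
  assert (Hkq1 : Rabs k < q) by (eapply Rlt_le_trans; [exact Hkq | apply Rmin_l]).
  assert (Hkq2 : Rabs k < q') by (eapply Rlt_le_trans; [exact Hkq | apply Rmin_r]).
  destruct (Hq' (t1 + k)) as [Hin1 Hclose]; [now replace (t1 + k - t1) with k by ring |].
  destruct (Hps (t1 + k) Hin1) as [_ E2].
  set (ds := p (t1 + k) - p t1) in *.
  assert (Hmain : Rabs (xs * ds + xt * k) <= r * Rmax (Rabs ds) (Rabs k)).
  { specialize (Hq (p (t1 + k)) (t1 + k)).
    replace (t1 + k - t1) with k in Hq by ring. fold ds in Hq.
    rewrite E1, E2 in Hq.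
    replace (c - c - (xs * ds + xt * k)) with (- (xs * ds + xt * k)) in Hq by ring.
    rewrite Rabs_Ropp in Hq. apply Hq; auto. destruct q; simpl in *; lra. }
  assert (Hk0 : 0 < Rabs k) by now apply Rabs_pos_lt.
  assert (Hmax : Rmax (Rabs ds) (Rabs k) <= Rabs ds + Rabs k).
  { apply Rmax_lub; pose proof (Rabs_pos ds); lra. }
  assert (Hxs : xs * Rabs ds <= Rabs (xs * ds + xt * k) + Rabs xt * Rabs k).
  { rewrite <- (Rabs_pos_eq xs) at 1 by lra. rewrite <- !Rabs_mult.
    replace (xs * ds) with ((xs * ds + xt * k) + - (xt * k)) at 1 by ring.
    eapply Rle_trans; [apply Rabs_triang |]. rewrite Rabs_Ropp. lra. }
  assert (Hds : Rabs ds <= K * Rabs k).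
  { assert (H1 : xs / 2 * Rabs ds <= (Rabs xt + xs) * Rabs k).
    { pose proof (Rabs_pos ds). nra. }
    apply (Rmult_le_reg_l (xs / 2)); [lra |]. unfold K.
    eapply Rle_trans; [exact H1 |]. right. field. lra. }
  assert (Hfin : Rabs (xs * ds + xt * k) <= eps * xs / 2 * Rabs k).
  { eapply Rle_trans; [exact Hmain |].
    apply Rle_trans with (r * ((K + 1) * Rabs k)).
    - apply Rmult_le_compat_l; lra.
    - rewrite <- Rmult_assoc. apply Rmult_le_compat_r; lra. }
  fold (p (t1 + k)) (p t1). fold ds.
  replace (ds / k - - (xt / xs)) with ((xs * ds + xt * k) / (xs * k)) by (field; lra).
  unfold Rdiv. rewrite Rabs_mult, Rabs_inv, Rabs_mult, (Rabs_pos_eq xs) by lra.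
  apply (Rmult_lt_reg_r (xs * Rabs k)); [now apply Rmult_lt_0_compat |].
  rewrite Rmult_assoc, Rinv_l, Rmult_1_r by nra.
  eapply Rle_lt_trans; [exact Hfin |].
  assert (0 < eps * xs * Rabs k) by (repeat apply Rmult_lt_0_compat; auto). lra.
Qed.
End Level.

(** Near [(s0, t0)], [b] is constant on the level curves of [x], along which [v] is a
    coordinate; these curves are labelled by their point on the line [t = t0]. *)
Definition straightened (U : R * R -> Prop) (x v b : R * R -> R) (s0 t0 : R) : Prop :=
  exists (a : R) (O V : R * R -> Prop),
    0 < a /\ open O /\ O (s0, t0) /\ (forall z, O z -> U z) /\ open V /\
    (forall s, Rabs (s - s0) < a -> U (s, t0)) /\
    (forall s r, V (s, r) -> Rabs (s - s0) < a) /\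
    (forall z, O z -> exists s, V (s, v z) /\ x z = x (s, t0) /\ b z = b (s, t0)) /\
    (forall s r, V (s, r) ->
       exists z, O z /\ v z = r /\ x z = x (s, t0) /\ b z = b (s, t0)).

Lemma straighten_pos (U : R * R -> Prop) (x v b : R * R -> R) (s0 t0 : R) :
  open U -> smooth_on U x -> smooth_on U v -> smooth_on U b -> U (s0, t0) ->
  (forall z, U z -> pd true b z * pd false x z = pd false b z * pd true x z) ->
  0 < pd true x (s0, t0) ->
  0 < pd false v (s0, t0) - pd true v (s0, t0) * (pd false x (s0, t0) / pd true x (s0, t0)) ->
  straightened U x v b s0 t0.
Proof.
  intros HU Sx Sv Sb U0 Hb Hx Hv.
  set (U1 := fun z => U z /\ 0 < pd true x z).
  assert (HU1 : open U1).
  { apply (open_preimage U (pd true x) (fun r => 0 < r)); auto; [| apply open_gt].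
    intros z Hz. apply (smooth_on_continuous U); auto. now apply smooth_on_pd. }
  (* The derivative of [v] along a level curve of [x] parametrized by [t], whose slope is minus the
     quotient of the partial derivatives of [x]. *)
  set (w := fun z => pd false v z - pd true v z * (pd false x z / pd true x z)).
  assert (S1 : forall f, smooth_on U f -> smooth_on U1 f).
  { intros f. apply smooth_on_sub. now intros z []. }
  assert (Sw : smooth_on U1 w).
  { apply smooth_on_minus; auto using smooth_on_pd.
    apply smooth_on_mult; auto using smooth_on_pd.
    apply smooth_on_div; auto using smooth_on_pd. intros z []. lra. }
  set (kappa := w (s0, t0) / 2).
  assert (Hk : 0 < kappa) by (unfold kappa, w; lra).
  set (U2 := fun z => U1 z /\ kappa < w z).
  assert (HU2 : open U2).
  { apply (open_preimage U1 w (fun r => kappa < r)); auto; [| apply open_gt].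
    intros z Hz. now apply (smooth_on_continuous U1). }
  destruct (HU2 (s0, t0)) as [e He]; [split; [now split | unfold kappa in *; lra] |].
  assert (HB : forall z, ball (s0, t0) e z -> U z /\ 0 < pd true x z).
  { intros z Hz. now destruct (He z Hz) as [[]]. }
  set (a := e / 2). assert (Ha : 0 < a < e) by (unfold a; destruct e; simpl; lra).
  destruct (level_bracket U x Sx s0 t0 e HB a Ha) as (d & Hd & Hbr).
  set (d' := d / 2).
  (* Within time [d'] on either side, [v] changes by at least [kappa * d' = 2 m] along a level
     curve. Its value on the line [t = t0] and the target are each within [m] of [v (s0, t0)], so
     the target is reached. *)
  set (m := kappa * d' / 2).
  assert (Hm : 0 < m) by (unfold m, d'; nra).
  assert (Hc : continuous (fun s => v (s, t0)) s0).
  { apply (@ex_derive_continuous R_AbsRing R_NormedModule).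
    apply (smooth_on_ex_derive U v true (s0, t0)); auto. }
  apply (proj1 (filterlim_locally _ _)) with (eps := mkposreal m Hm) in Hc.
  destruct Hc as [a1 Ha1].
  assert (Ha1' : forall s, Rabs (s - s0) < a1 -> Rabs (v (s, t0) - v (s0, t0)) < m)
    by exact Ha1.
  (* Level curves meeting the line [t = t0] within [a2] of [s0] start with [v] within [m] of its
     central value. *)
  set (a2 := Rmin (a1 / 2) a).
  assert (Ha2 : 0 < a2 < e /\ a2 < a1 /\ a2 <= a).
  { unfold a2, Rmin. destruct a1 as [a1 P1]; simpl in *. destruct Rle_dec; lra. }
  destruct Ha2 as (Ha2 & Ha21 & Ha2a).
  destruct (level_bracket U x Sx s0 t0 e HB a2 Ha2) as (d2 & Hd2 & Hbr2).
  set (n := Rmin d d2). assert (Hn : 0 < n) by (apply Rmin_pos; lra).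
  assert (Hnd : n <= d) by apply Rmin_l. assert (Hnd2 : n <= d2) by apply Rmin_r.
  assert (Hbox : forall s t, Rabs (s - s0) < a -> Rabs (t - t0) < d -> ball (s0, t0) e (s, t)).
  { intros s t Hs Ht. apply ball_R2; simpl. lra. }
  assert (H00 : Rabs (t0 - t0) < d) by (rewrite Rminus_diag, Rabs_R0; lra).
  assert (Hlev : forall c, Rabs (c - x (s0, t0)) < n ->
    exists p, (forall t, Rabs (t - t0) < d -> Rabs (p t - s0) < a /\ x (p t, t) = c /\
        b (p t, t) = b (p t0, t0) /\
        derivable_pt_lim (fun t => v (p t, t)) t (w (p t, t))) /\
      Rabs (v (p t0, t0) - v (s0, t0)) < m).
  { intros c Hc.
    destruct (level_curve U HU x Sx s0 t0 e HB a d c Ha Hd) as [p Hp].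
    { intros t Ht. apply Hbr; [exact Ht | exact (Rlt_le_trans _ _ _ Hc Hnd)]. }
    assert (Hder : forall f t, smooth_on U f -> Rabs (t - t0) < d ->
      derivable_pt_lim (fun t => f (p t, t)) t
        (pd true f (p t, t) * (- (pd false x (p t, t) / pd true x (p t, t)))
         + pd false f (p t, t))).
    { intros f t Sf Ht. destruct (Hp t Ht) as (Hs & _ & Hder).
      apply (smooth_derive_along U f p t); auto. now apply HB, Hbox. }
    exists p. split.
    - intros t Ht. destruct (Hp t Ht) as (Hs & Ec & _).
      split; [exact Hs | split; [exact Ec | split]].
      + destruct (MVT_gen (fun t => b (p t, t)) t0 t (fun _ => 0)) as (r & _ & E).
        * intros r Hr. apply is_derive_Reals.
          assert (Hr' : Rabs (r - t0) < d).
          { apply Rabs_def2 in Ht. apply Rabs_def1; revert Hr;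
              unfold Rmin, Rmax; destruct Rle_dec; lra. }
          assert (Hz : ball (s0, t0) e (p r, r)) by (apply Hbox; auto; now apply Hp).
          destruct (HB _ Hz) as [HzU Hpos].
          replace 0 with (pd true b (p r, r) * (- (pd false x (p r, r) / pd true x (p r, r)))
            + pd false b (p r, r)); [now apply Hder |].
          apply (Rmult_eq_reg_r (pd true x (p r, r))); [| lra].
          transitivity (pd false b (p r, r) * pd true x (p r, r)
            - pd true b (p r, r) * pd false x (p r, r)); [field; lra |].
          rewrite Hb by auto. ring.
        * intros r Hr.
          assert (Hr' : Rabs (r - t0) < d).
          { apply Rabs_def2 in Ht. apply Rabs_def1; revert Hr;
              unfold Rmin, Rmax; destruct Rle_dec; lra. }
          apply derivable_continuous_pt. eexists. exact (Hder b r Sb Hr').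
        * apply Rminus_diag_uniq. etransitivity; [exact E | ring].
      + replace (w (p t, t)) with (pd true v (p t, t) *
          (- (pd false x (p t, t) / pd true x (p t, t))) + pd false v (p t, t))
          by (unfold w; ring).
        now apply Hder.
    - apply Ha1'. destruct (Hp t0 H00) as (Hs & Ec & _). apply Rabs_def2 in Hs.
      destruct (Hbr2 t0 c) as [L1 L2]; [rewrite Rminus_diag, Rabs_R0; lra | lra |].
      apply Rlt_trans with a2; [| exact Ha21]. apply Rabs_def1.
      + destruct (Rlt_le_dec (p t0 - s0) a2) as [| Hle]; [assumption | exfalso].
        destruct (Req_dec (p t0) (s0 + a2)) as [E | Hne]; [rewrite E in Ec; lra |].
        assert (x (s0 + a2, t0) < x (p t0, t0)); [| lra].
        apply (level_increasing U x Sx s0 t0 e HB); lra.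
      + destruct (Rlt_le_dec (- a2) (p t0 - s0)) as [| Hle]; [assumption | exfalso].
        destruct (Req_dec (p t0) (s0 - a2)) as [E | Hne]; [rewrite E in Ec; lra |].
        assert (x (p t0, t0) < x (s0 - a2, t0)); [| lra].
        apply (level_increasing U x Sx s0 t0 e HB); lra. }
  assert (Hinj : forall s s' t, Rabs (s - s0) < a -> Rabs (s' - s0) < a -> Rabs (t - t0) < d ->
    x (s, t) = x (s', t) -> s = s').
  { intros s s' t Hs Hs' Ht E. apply Rabs_def2 in Hs. apply Rabs_def2 in Hs'.
    destruct (Rtotal_order s s') as [L | [-> | L]]; auto; exfalso.
    - assert (x (s, t) < x (s', t)); [| lra].
      apply (level_increasing U x Sx s0 t0 e HB); lra.
    - assert (x (s', t) < x (s, t)); [| lra].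
      apply (level_increasing U x Sx s0 t0 e HB); lra. }
  set (I := @ball R_UniformSpace).
  set (Box := fun z : R * R => I s0 a (fst z) /\ I t0 d (snd z)).
  assert (HBox : open Box).
  { apply open_and.
    - apply (open_comp fst); [intros; apply continuous_fst | apply open_ball_R].
    - apply (open_comp snd); [intros; apply continuous_snd | apply open_ball_R]. }
  assert (BoxU : forall z, Box z -> U z).
  { intros [s t] [H1 H2]. apply HB, Hbox; assumption. }
  (* Both sets impose the same bounds on [x] and on the value of [v]. A point and the foot of its
     level curve share [x], so membership passes in both directions. *)
  exists a, (fun z => (Box z /\ I (x (s0, t0)) n (x z)) /\ I (v (s0, t0)) m (v z)),
    (fun z => (I s0 a (fst z) /\ I (x (s0, t0)) n (x (fst z, t0))) /\
              I (v (s0, t0)) m (snd z)).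
  assert (C0 : forall r (q : R), 0 < q -> I r q r).
  { intros r q Hq. change (Rabs (r - r) < q). rewrite Rminus_diag, Rabs_R0. exact Hq. }
  split; [lra | split; [| split; [| split; [| split; [| split; [| split; [| split]]]]]]].
  - apply (open_preimage (fun z => Box z /\ I (x (s0, t0)) n (x z)) v).
    + apply (open_preimage Box x); auto using open_ball_R.
      intros z Hz. apply (smooth_on_continuous U); auto.
    + intros z [Hz _]. apply (smooth_on_continuous U); auto.
    + apply open_ball_R.
  - repeat split; apply C0; lra.
  - intros z [[Hz _] _]. auto.
  - apply (open_and (fun z => I s0 a (fst z) /\ I (x (s0, t0)) n (x (fst z, t0)))
      (fun z => I (v (s0, t0)) m (snd z))).
    + apply (open_preimage (fun z => I s0 a (fst z)) (fun z => x (fst z, t0))).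
      * apply (open_comp fst); [intros; apply continuous_fst | apply open_ball_R].
      * intros z Hz. apply (continuous_comp fst (fun s => x (s, t0))).
        -- apply continuous_fst.
        -- apply (@ex_derive_continuous R_AbsRing R_NormedModule).
           apply (smooth_on_ex_derive U x true (fst z, t0)); auto. apply HB, Hbox; auto.
      * apply open_ball_R.
    + apply (open_comp snd); [intros; apply continuous_snd | apply open_ball_R].
  - intros s Hs. apply HB, Hbox; auto.
  - intros s r [[Hs _] _]. exact Hs.
  - intros [s t] [[[Hs Ht] Hxz] Hvz]. simpl in Hs, Ht.
    destruct (Hlev (x (s, t)) Hxz) as (p & Hp & _).
    destruct (Hp t Ht) as (Hpt & Ep & Eb & _).
    destruct (Hp t0 H00) as (Hpt0 & Ep0 & _).
    exists (p t0). assert (p t = s) by (apply (Hinj (p t) s t); auto). subst s.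
    split; [| split; [now rewrite Ep0 | exact Eb]].
    split; [split; [exact Hpt0 |] | exact Hvz]. simpl. rewrite Ep0. exact Hxz.
  - intros s r [[Hs Hxs] Hr]. simpl in Hs, Hxs, Hr.
    change (Rabs (r - v (s0, t0)) < m) in Hr.
    destruct (Hlev (x (s, t0)) Hxs) as (p & Hp & Hv0).
    destruct (Hp t0 H00) as (Hpt0 & Ep0 & _).
    assert (p t0 = s) by (apply (Hinj (p t0) s t0); auto).
    assert (Hd' : 0 < d' < d) by (unfold d'; lra).
    assert (Hin : forall t, t0 - d' <= t <= t0 + d' -> Rabs (t - t0) < d).
    { intros t Ht. apply Rabs_def1; lra. }
    assert (Hcont : forall t, t0 - d' <= t <= t0 + d' ->
      continuous (fun t => v (p t, t) - r) t).
    { intros t Ht. apply (continuous_minus (fun t => v (p t, t)) (fun _ => r)).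
      - apply continuity_pt_filterlim, derivable_continuous_pt. eexists.
        now apply Hp, Hin.
      - apply continuous_const. }
    assert (Hgrow : forall t1 t2, t0 - d' <= t1 -> t1 < t2 -> t2 <= t0 + d' ->
      kappa * (t2 - t1) <= v (p t2, t2) - v (p t1, t1)).
    { intros t1 t2 H1 H2 H3.
      destruct (MVT_gen (fun t => v (p t, t)) t1 t2 (fun t => w (p t, t))) as (c & Hc & E).
      - intros t Ht. rewrite Rmin_left, Rmax_right in Ht by lra. apply is_derive_Reals.
        apply Hp, Hin. lra.
      - intros t Ht. rewrite Rmin_left, Rmax_right in Ht by lra.
        apply derivable_continuous_pt. eexists. apply Hp, Hin. lra.
      - rewrite E. apply Rmult_le_compat_r; [lra |].
        rewrite Rmin_left, Rmax_right in Hc by lra.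
        assert (Hcin : Rabs (c - t0) < d) by (apply Hin; lra).
        assert (Hz : ball (s0, t0) e (p c, c)) by (apply Hbox; auto; now apply Hp).
        destruct (He _ Hz) as [_ Hw]. lra. }
    apply Rabs_def2 in Hr. apply Rabs_def2 in Hv0.
    assert (Hkd : kappa * d' = 2 * m) by (unfold m; field).
    destruct (IVT_open (fun t => v (p t, t) - r) (t0 - d') (t0 + d')) as (t & Ht & Et).
    + lra.
    + exact Hcont.
    + pose proof (Hgrow t0 (t0 + d')). pose proof (Hgrow (t0 - d') t0).
      replace (t0 + d' - t0) with d' in * by ring.
      replace (t0 - (t0 - d')) with d' in * by ring. lra.
    + assert (Htin : Rabs (t - t0) < d) by (apply Hin; lra).
      destruct (Hp t Htin) as (Hpt & Ep & Eb & _).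
      exists (p t, t). split; [| split; [lra | split]].
      * split; [split; [split; [exact Hpt | exact Htin] |] |].
        -- rewrite Ep. exact Hxs.
        -- change (Rabs (v (p t, t) - v (s0, t0)) < m). apply Rabs_def1; lra.
      * exact Ep.
      * rewrite Eb. now rewrite H.
Qed.

Lemma continuous_pair {T S S' : UniformSpace} (f : T -> S) (g : T -> S') z :
  continuous f z -> continuous g z -> continuous (fun z => (f z, g z)) z.
Proof.
  intros Hf Hg. apply (continuous_comp_2 f g pair); auto.
  apply (continuous_ext (fun u => u)); [now intros [] | apply continuous_id].
Qed.

Lemma pd_scal k c f z : pd k (fun z => c * f z) z = c * pd k f z.
Proof. exact (Derive_scal _ _ _). Qed.

(** The factors [k], [l] of square 1 adjust the signs of [x] and [v]; only the second coordinate of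
    [V] has to be reflected back. *)
Lemma straighten (U : R * R -> Prop) (x v b : R * R -> R) (s0 t0 : R) :
  open U -> smooth_on U x -> smooth_on U v -> smooth_on U b -> U (s0, t0) ->
  (forall z, U z -> pd true b z * pd false x z = pd false b z * pd true x z) ->
  pd true x (s0, t0) <> 0 ->
  pd true x (s0, t0) * pd false v (s0, t0) - pd false x (s0, t0) * pd true v (s0, t0) <> 0 ->
  straightened U x v b s0 t0.
Proof.
  intros HU Sx Sv Sb U0 Hb Hx HJ.
  set (w := pd false v (s0, t0) - pd true v (s0, t0) *
    (pd false x (s0, t0) / pd true x (s0, t0))).
  assert (Hw : w <> 0).
  { intros E. apply HJ. transitivity (w * pd true x (s0, t0)); [unfold w; now field |].
    rewrite E. ring. }
  assert (Hsgn : forall r, r <> 0 -> exists k, k * k = 1 /\ 0 < k * r).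
  { intros r Hr. destruct (Rdichotomy r 0 Hr); [exists (-1) | exists 1]; lra. }
  destruct (Hsgn _ Hx) as (k & Hk & Hkx), (Hsgn _ Hw) as (l & Hl & Hlw).
  assert (Hk0 : k <> 0) by (intros ->; lra).
  destruct (straighten_pos U (fun z => k * x z) (fun z => l * v z) b s0 t0)
    as (a & O & V & H1 & H2 & H3 & H4 & H5 & H6 & H7 & H8 & H9); auto.
  - apply smooth_on_mult; auto using smooth_on_const.
  - apply smooth_on_mult; auto using smooth_on_const.
  - intros z Hz. rewrite !pd_scal. specialize (Hb z Hz). nra.
  - now rewrite pd_scal.
  - rewrite !pd_scal. replace (_ - _) with (l * w); [exact Hlw |].
    unfold w. field. now split.
  - exists a, O, (fun z => V (fst z, l * snd z)).
    repeat (split; [assumption |]). split; [| split; [assumption | split; [| split]]].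
    + apply (open_comp (fun z : R * R => (fst z, l * snd z)) V); auto. intros z _.
      apply (continuous_pair fst (fun z : R * R => l * snd z)); [apply continuous_fst |].
      apply (continuous_mult (fun _ => l) snd); [apply continuous_const | apply continuous_snd].
    + intros s r. apply H7.
    + intros z Hz. destruct (H8 z Hz) as (s & E1 & E2 & E3). exists s.
      split; [exact E1 | split; [| exact E3]]. now apply (Rmult_eq_reg_l k).
    + intros s r Hs. destruct (H9 s _ Hs) as (z & Hz & E1 & E2 & E3). exists z.
      split; [exact Hz | split; [| split; [now apply (Rmult_eq_reg_l k) | exact E3]]].
      apply (Rmult_eq_reg_l l); auto. intros ->; lra.
Qed.

(** * Null surfaces spanned by their rotated position vector *)

Lemma model_surfaceE alpha beta y v : model_surface alpha beta y v =
  ((/ sqrt 2 * (beta y * cos v + alpha y * sin v),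
    / sqrt 2 * (beta y * sin v - alpha y * cos v)),
   (/ sqrt 2 * (alpha y * sin v - beta y * cos v),
    / sqrt 2 * (- (beta y * sin v) - alpha y * cos v))).
Proof.
  apply C2_ext; unfold model_surface, w1, w2, rscal, exp_i, plus, scal, mult; simpl;
    unfold mult; simpl; ring.
Qed.

(** With [u] the vector written as [q w1 + p w2] up to the factor [sqrt 2]: nullity makes
    [q / p] real, and [p] has argument [v]. *)
Lemma null_vector_model (u : C2) alpha beta y :
  let p1 := proj true true u - proj false true u in
  let p2 := proj true false u - proj false false u in
  let q1 := - proj true false u - proj false false u in
  metric u u = 0 -> 0 < p1 ->
  alpha y = q1 / p1 * beta y -> beta y = sqrt (p1 * p1 + p2 * p2) * / sqrt 2 ->
  model_surface alpha beta y (atan (p2 / p1)) = u.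
Proof.
  intros p1 p2 q1 Hn Hp Ha Hb.
  (* [q2] is the imaginary part of [q], and nullity says that [q] times the conjugate of [p] is
     real. *)
  set (q2 := proj true true u + proj false true u).
  assert (Hq : q2 = q1 / p1 * p2).
  { apply (Rmult_eq_reg_r p1); [| lra]. transitivity (q1 * p2); [| field; lra].
    rewrite proj_metric in Hn. unfold p1, p2, q1, q2 in *. lra. }
  assert (H2 : / sqrt 2 * / sqrt 2 = / 2).
  { rewrite <- Rinv_mult, sqrt_sqrt; lra. }
  set (n := p2 / p1).
  assert (Hs : 0 < sqrt (1 + n * n)) by (apply sqrt_lt_R0; nra).
  assert (Hbn : beta y = p1 * sqrt (1 + n * n) * / sqrt 2).
  { rewrite Hb. f_equal. rewrite <- (sqrt_square p1) at 3 by lra.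
    rewrite <- sqrt_mult by nra. f_equal. unfold n. field. lra. }
  assert (Hc : beta y * cos (atan n) = / sqrt 2 * p1).
  { rewrite Hbn, cos_atan. unfold Rsqr. field. split; [| lra].
    apply Rgt_not_eq, sqrt_lt_R0; lra. }
  assert (Hsi : beta y * sin (atan n) = / sqrt 2 * p2).
  { rewrite Hbn, sin_atan. unfold Rsqr.
    replace p2 with (n * p1) by (unfold n; field; lra). field.
    split; [| lra]. apply Rgt_not_eq, sqrt_lt_R0; lra. }
  rewrite model_surfaceE, Ha. fold n.
  assert (K : forall t, t = / 2 * (2 * t)) by (intros; field).
  apply C2_ext; simpl.
  - transitivity (/ sqrt 2 * (beta y * cos (atan n) + q1 / p1 * (beta y * sin (atan n))));
      [ring |]. rewrite Hc, Hsi.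
    transitivity (/ sqrt 2 * / sqrt 2 * (p1 + q1 / p1 * p2)); [ring |].
    rewrite H2, <- Hq. unfold p1, q2, proj. simpl. field.
  - transitivity (/ sqrt 2 * (beta y * sin (atan n) - q1 / p1 * (beta y * cos (atan n))));
      [ring |]. rewrite Hc, Hsi.
    transitivity (/ sqrt 2 * / sqrt 2 * (p2 - q1));
      [field; split; [| lra]; apply Rgt_not_eq, sqrt_lt_R0; lra |].
    rewrite H2. unfold p2, q1, proj. simpl. field.
  - transitivity (/ sqrt 2 * (q1 / p1 * (beta y * sin (atan n)) - beta y * cos (atan n)));
      [ring |]. rewrite Hc, Hsi.
    transitivity (/ sqrt 2 * / sqrt 2 * (q1 / p1 * p2 - p1)); [ring |].
    rewrite H2, <- Hq. unfold p1, q2, proj. simpl. field.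
  - transitivity (/ sqrt 2 * (- (beta y * sin (atan n)) - q1 / p1 * (beta y * cos (atan n))));
      [ring |]. rewrite Hc, Hsi.
    transitivity (/ sqrt 2 * / sqrt 2 * (- p2 - q1));
      [field; split; [| lra]; apply Rgt_not_eq, sqrt_lt_R0; lra |].
    rewrite H2. unfold p2, q1, proj. simpl. field.
Qed.

Definition locally_model (O : R * R -> Prop) (g : R * R -> C2) : Prop :=
  exists (alpha beta : R -> R) (V : R * R -> Prop),
    smooth1 alpha /\ smooth1 beta /\
    (forall x, Derive alpha x * beta x - alpha x * Derive beta x <> 0) /\
    open V /\
    (forall u, (exists z, O z /\ g z = u) <->
       (exists x v, V (x, v) /\ model_surface alpha beta x v = u)).

(** Two functions with zero derivative along the same nonzero vector have parallel gradients. *)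
Lemma colinear_2 x1 x2 a b c d : x1 <> 0 \/ x2 <> 0 ->
  x1 * a + x2 * b = 0 -> x1 * c + x2 * d = 0 -> a * d = b * c.
Proof.
  intros [H | H] E1 E2.
  - apply (Rmult_eq_reg_l x1); auto.
    transitivity ((x1 * a + x2 * b) * d - x2 * b * d); [ring | rewrite E1].
    transitivity (b * (x1 * c + x2 * d) - x2 * b * d); [rewrite E2; ring | ring].
  - apply (Rmult_eq_reg_l x2); auto.
    transitivity (a * (x1 * c + x2 * d) - x1 * a * c); [ring | rewrite E2].
    transitivity ((x1 * a + x2 * b) * c - x1 * a * c); [rewrite E1; ring | ring].
Qed.

(** Reparametrizes a curve defined near [s0] by the whole real line, as [smooth1] demands. *)
Definition squeeze (s0 a y : R) : R := s0 + a * (2 / PI) * atan y.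

Lemma squeeze_bound s0 a y : 0 < a -> Rabs (squeeze s0 a y - s0) < a.
Proof.
  intros Ha. destruct (atan_bound y) as [H1 H2]. pose proof PI_RGT_0.
  unfold squeeze. replace (s0 + a * (2 / PI) * atan y - s0) with (a * (2 / PI * atan y)) by ring.
  assert (-1 < 2 / PI * atan y < 1).
  { split; apply (Rmult_lt_reg_l (PI / 2)); try lra;
      replace (PI / 2 * (2 / PI * atan y)) with (atan y) by (field; lra); lra. }
  apply Rabs_def1; nra.
Qed.

Lemma squeeze_onto s0 a s : 0 < a -> Rabs (s - s0) < a -> exists y, squeeze s0 a y = s.
Proof.
  intros Ha Hs. apply Rabs_def2 in Hs. pose proof PI_RGT_0.
  exists (tan ((s - s0) / a * (PI / 2))). unfold squeeze.
  rewrite atan_tan; [field; lra |].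
  assert (-1 < (s - s0) / a < 1).
  { split; apply (Rmult_lt_reg_l a); try lra;
      replace (a * ((s - s0) / a)) with (s - s0) by (field; lra); lra. }
  nra.
Qed.

Lemma is_derive_squeeze s0 a y :
  is_derive (squeeze s0 a) y (a * (2 / PI) * / (1 + y * y)).
Proof.
  unfold squeeze. evar_last.
  - apply (is_derive_plus (fun _ => s0)); [apply is_derive_const |].
    apply is_derive_scal, is_derive_atan.
  - unfold plus, zero; simpl. unfold Rsqr. ring.
Qed.

Section Model.
Context (U : R * R -> Prop) (HU : open U) (g : R * R -> C2) (Sg : smooth_C2_on U g).
Context (s0 t0 r : R) (U0 : U (s0, t0)) (Hr : 0 < r).
Context (g0 : g (s0, t0) = ((r, 0), (- r, 0))).
Context (Hnull : forall z, U z -> metric (g z) (g z) = 0).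
Context (Hpos : forall z, U z -> exists x1 x2 : R,
  J (g z) = plus (rscal x1 (vpd true g z)) (rscal x2 (vpd false g z))).

(** At the base point [p = 2 r] and [q = 0], so [Htrans] says precisely that [x = q / p] has nonzero
    first partial derivative there. *)
Lemma local_model : metric (vpd true g (s0, t0)) (J (g (s0, t0))) <> 0 ->
  exists O : R * R -> Prop, open O /\ O (s0, t0) /\ (forall z, O z -> U z) /\ locally_model O g.
Proof.
  intros Htrans.
  set (G := fun i j z => proj i j (g z)).
  assert (SG : forall i j, smooth_on U (G i j)) by now apply smooth_C2_proj.
  set (p1 := fun z => G true true z - G false true z).
  set (p2 := fun z => G true false z - G false false z).
  set (q1 := fun z => - G true false z - G false false z).
  set (q2 := fun z => G true true z + G false true z).
  assert (Sp1 : smooth_on U p1) by (apply smooth_on_minus; auto).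
  assert (Sp2 : smooth_on U p2) by (apply smooth_on_minus; auto).
  assert (Sq1 : smooth_on U q1)
    by (apply smooth_on_minus; auto; now apply smooth_on_opp).
  assert (Sq2 : smooth_on U q2) by (apply smooth_on_plus; auto).
  assert (Dm : forall k z f f', U z -> smooth_on U f -> smooth_on U f' ->
    pd k (fun z => f z - f' z) z = pd k f z - pd k f' z).
  { intros k z f f' Hz Sf Sf'.
    exact (Derive_minus _ _ _ (smooth_on_ex_derive U f k z Sf Hz)
      (smooth_on_ex_derive U f' k z Sf' Hz)). }
  assert (Do : forall k z f, pd k (fun z => - f z) z = - pd k f z).
  { intros k z f. exact (Derive_opp _ _). }
  (* Along the field with coordinates [x1], [x2], both [p] and [q] are multiplied by [i]; these are
     the parts of that statement needed below. *)
  assert (Hxi : forall z, U z -> exists x1 x2 : R,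
    x1 * pd true p1 z + x2 * pd false p1 z = - p2 z /\
    x1 * pd true p2 z + x2 * pd false p2 z = p1 z /\
    x1 * pd true q1 z + x2 * pd false q1 z = - q2 z).
  { intros z Hz. destruct (Hpos z Hz) as (x1 & x2 & E). exists x1, x2.
    assert (P : forall i j, x1 * pd true (G i j) z + x2 * pd false (G i j) z =
      (if j then -1 else 1) * G i (negb j) z).
    { intros i j. apply (f_equal (proj i j)) in E.
      rewrite proj_J, proj_plus, !proj_rscal, !proj_vpd in E. symmetry. exact E. }
    pose proof (P true true) as P1. pose proof (P true false) as P2.
    pose proof (P false true) as P3. pose proof (P false false) as P4.
    cbv [negb] in P1, P2, P3, P4.
    unfold p1, p2, q1.
    rewrite !(Dm _ z (G true true) (G false true)), !(Dm _ z (G true false) (G false false)),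
      !(Dm _ z (fun z => - G true false z) (G false false)), !(Do _ z (G true false))
      by auto using smooth_on_opp.
    unfold q2. lra. }
  assert (Hq : forall z, U z -> q1 z * p2 z = q2 z * p1 z).
  { intros z Hz. specialize (Hnull z Hz). rewrite proj_metric in Hnull.
    unfold q1, q2, p1, p2, G. lra. }
  set (U1 := fun z => U z /\ 0 < p1 z).
  assert (HU1 : open U1).
  { apply (open_preimage U p1 (fun t => 0 < t)); auto; [| apply open_gt].
    intros z Hz. now apply (smooth_on_continuous U). }
  assert (S1 : forall f, smooth_on U f -> smooth_on U1 f).
  { intros f. apply smooth_on_sub. now intros z []. }
  set (x := fun z => q1 z / p1 z).
  set (n := fun z => p1 z * p1 z + p2 z * p2 z).
  set (v := fun z => atan (p2 z / p1 z)).
  assert (Hp1 : forall z, U1 z -> p1 z <> 0) by (intros z []; lra).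
  assert (Sx : smooth_on U1 x) by (apply smooth_on_div; auto).
  assert (Sn : smooth_on U1 n).
  { apply smooth_on_plus; auto; apply smooth_on_mult; auto. }
  assert (Sv : smooth_on U1 v).
  { apply (smooth_on_atan U1 HU1 (fun z => p2 z / p1 z)). apply smooth_on_div; auto. }
  assert (Dn : forall k z, U1 z -> pd k n z = 2 * (p1 z * pd k p1 z + p2 z * pd k p2 z)).
  { intros k z Hz. unfold n.
    rewrite (pd_plus_on U1 k z Hz (fun z => p1 z * p1 z) (fun z => p2 z * p2 z))
      by (apply smooth_on_mult; auto).
    rewrite !(pd_mult_on U1 k z Hz) by auto. ring. }
  assert (Dd : forall k z f, U1 z -> smooth_on U1 f ->
    pd k (fun z => f z / p1 z) z = (pd k f z * p1 z - f z * pd k p1 z) / (p1 z * p1 z)).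
  { intros k z f Hz Sf. unfold Rdiv at 1.
    rewrite (pd_mult_on U1 k z Hz f (fun z => / p1 z)) by auto using smooth_on_inv.
    rewrite pd_inv by (auto; apply (smooth_on_ex_derive U1); auto).
    specialize (Hp1 z Hz). field. exact Hp1. }
  assert (Dv : forall k z, U1 z ->
    pd k v z = (pd k p2 z * p1 z - p2 z * pd k p1 z) / n z).
  { intros k z Hz. unfold v.
    rewrite (pd_comp k (fun z => p2 z / p1 z) z).
    - rewrite Dd by auto. rewrite (is_derive_unique _ _ _ (is_derive_atan _)).
      unfold n, Rsqr. specialize (Hp1 z Hz).
      assert (p1 z * p1 z + p2 z * p2 z <> 0) by (apply Rgt_not_eq; destruct Hz; nra).
      field. repeat split; auto; rewrite Rplus_comm; auto.
    - apply (smooth_on_ex_derive U1 (fun z => p2 z / p1 z)); auto.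
      apply smooth_on_div; auto.
    - eexists; apply is_derive_atan. }
  assert (Hn : forall z, U1 z -> 0 < n z) by (intros z []; unfold n; nra).
  assert (Hflow : forall z, U1 z -> exists x1 x2 : R,
    x1 * pd true x z + x2 * pd false x z = 0 /\
    x1 * pd true n z + x2 * pd false n z = 0 /\
    x1 * pd true v z + x2 * pd false v z = 1).
  { intros z Hz. destruct (Hxi z (proj1 Hz)) as (x1 & x2 & E1 & E2 & E3).
    specialize (Hq z (proj1 Hz)). specialize (Hn z Hz). pose proof (Hp1 z Hz) as Hp.
    exists x1, x2. unfold x. rewrite !Dd, !Dn, !Dv by auto. split; [| split].
    - transitivity (((x1 * pd true q1 z + x2 * pd false q1 z) * p1 z -
        q1 z * (x1 * pd true p1 z + x2 * pd false p1 z)) / (p1 z * p1 z)); [field; auto |].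
      rewrite E1, E3. transitivity ((q1 z * p2 z - q2 z * p1 z) / (p1 z * p1 z));
        [field; auto |]. rewrite Hq. field; auto.
    - transitivity (2 * (p1 z * (x1 * pd true p1 z + x2 * pd false p1 z) +
        p2 z * (x1 * pd true p2 z + x2 * pd false p2 z))); [ring |].
      rewrite E1, E2. ring.
    - transitivity (((x1 * pd true p2 z + x2 * pd false p2 z) * p1 z -
        p2 z * (x1 * pd true p1 z + x2 * pd false p1 z)) / n z); [field; lra |].
      rewrite E1, E2. unfold n in *. field. lra. }
  set (U2 := fun z => U1 z /\ pd true x z <> 0).
  assert (HU2 : open U2).
  { apply (open_preimage U1 (pd true x) (fun t => t <> 0)); auto; [| apply open_neq].
    intros z Hz. apply (smooth_on_continuous U1); auto. now apply smooth_on_pd. }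
  assert (U10 : U1 (s0, t0)).
  { split; auto. unfold p1, G. rewrite g0. unfold proj; simpl. lra. }
  assert (Hx0 : pd true x (s0, t0) <> 0).
  { intros E. apply Htrans. unfold x in E. rewrite Dd in E by auto.
    assert (Eq : q1 (s0, t0) = 0) by (unfold q1, G; rewrite g0; unfold proj; simpl; ring).
    assert (Ep : p1 (s0, t0) = 2 * r) by (unfold p1, G; rewrite g0; unfold proj; simpl; ring).
    assert (Edq : pd true q1 (s0, t0) = 0).
    { apply (Rmult_eq_reg_r (/ p1 (s0, t0))).
      - rewrite Rmult_0_l, <- E, Eq. field. auto.
      - apply Rinv_neq_0_compat; auto. }
    unfold q1 in Edq.
    rewrite (Dm _ _ (fun z => - G true false z) (G false false)), (Do _ _ (G true false)) in Edq
      by auto using smooth_on_opp.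
    rewrite proj_metric, !proj_J, !proj_vpd, g0. unfold proj; simpl.
    unfold G, proj in Edq. transitivity (r * (- pd true (fun z => snd (fst (g z))) (s0, t0)
      - pd true (fun z => snd (snd (g z))) (s0, t0))); [ring |].
    rewrite Edq. ring. }
  assert (U20 : U2 (s0, t0)) by now split.
  assert (S2 : forall f, smooth_on U1 f -> smooth_on U2 f).
  { intros f. apply smooth_on_sub. now intros z []. }
  destruct (straighten U2 x v n s0 t0) as (a & O & V & Ha & HO & O0 & HOU & HV & Hline &
    Hva & Hfwd & Hbwd); auto.
  { intros z [Hz _]. destruct (Hflow z Hz) as (x1 & x2 & E1 & E2 & E3).
    apply (colinear_2 x1 x2); auto.
    destruct (Req_dec x1 0) as [-> |]; [right; intros ->; lra | now left]. }
  (* Since the flow fixes [x] and moves [v] with unit speed, [x2] times the Jacobian of [x], [v] is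
     [pd true x]. *)
  { destruct (Hflow _ U10) as (x1 & x2 & E1 & E2 & E3). intros E. apply Hx0.
    transitivity (pd true x (s0, t0) * (x1 * pd true v (s0, t0) + x2 * pd false v (s0, t0))
      - (x1 * pd true x (s0, t0) + x2 * pd false x (s0, t0)) * pd true v (s0, t0));
      [rewrite E1, E3; ring |].
    transitivity (x2 * (pd true x (s0, t0) * pd false v (s0, t0) -
      pd false x (s0, t0) * pd true v (s0, t0))); [ring | rewrite E; ring]. }
  exists O. split; [exact HO | split; [exact O0 | split]].
  { intros z Hz. now destruct (HOU z Hz) as [[]]. }
  set (phi := squeeze s0 a).
  assert (Hphi : forall y, U2 (phi y, t0)).
  { intros y. apply Hline. now apply squeeze_bound. }
  set (X := fun y => x (phi y, t0)).
  (* [p1] and [p2] are [sqrt 2] times the parts of the coefficient of [w2], hence the factor. *)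
  set (beta := fun y => sqrt (n (phi y, t0)) * / sqrt 2).
  assert (Dphi : forall y, ex_derive phi y).
  { intros y. eexists. apply is_derive_squeeze. }
  assert (Sline : forall f, smooth_on U2 f ->
    smooth_on (fun _ => True) (fun w => f (phi (fst w), t0))).
  { intros f Sf. apply (smooth_on_line U2); auto.
    apply (smooth_on_ext _ (fun w : R * R => a * (2 / PI) * / (1 + fst w * fst w))).
    - apply open_true.
    - intros w _. symmetry. apply is_derive_unique, is_derive_squeeze.
    - pose proof smooth_on_fst as Sid.
      apply smooth_on_mult; [apply open_true | apply smooth_on_const |].
      apply smooth_on_inv; [apply open_true | intros w _; apply Rgt_not_eq; nra |].
      apply smooth_on_plus; [apply open_true | apply smooth_on_const |].
      apply smooth_on_mult; auto; apply open_true. }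
  assert (SX : smooth_on (fun _ => True) (fun w => X (fst w))) by (apply (Sline x); auto).
  assert (Sbeta : smooth_on (fun _ => True) (fun w => beta (fst w))).
  { apply smooth_on_mult; [apply open_true | | apply smooth_on_const].
    apply (Sline (fun z => sqrt (n z))). apply smooth_on_sqrt; auto.
    intros z [Hz _]. auto. }
  assert (Hbeta : forall y, beta y <> 0).
  { intros y. apply Rmult_integral_contrapositive. split.
    - apply Rgt_not_eq, sqrt_lt_R0, Hn. apply (Hphi y).
    - apply Rinv_neq_0_compat, Rgt_not_eq, sqrt_lt_R0. lra. }
  assert (DX : forall y, Derive X y <> 0).
  { intros y. unfold X.
    rewrite (Derive_comp (fun s => x (s, t0)) phi); auto.
    - rewrite (is_derive_unique phi y _ (is_derive_squeeze s0 a y)).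
      apply Rmult_integral_contrapositive. split.
      + pose proof PI_RGT_0.
        apply Rmult_integral_contrapositive. split.
        * apply Rmult_integral_contrapositive. split; [lra |].
          apply Rmult_integral_contrapositive. split; [lra |].
          apply Rinv_neq_0_compat. lra.
        * apply Rinv_neq_0_compat, Rgt_not_eq. nra.
      + exact (proj2 (Hphi y)).
    - exact (smooth_on_ex_derive U2 x true (phi y, t0) (S2 x Sx) (Hphi y)). }
  assert (EX : forall y, ex_derive X y).
  { intros y. exact (smooth1_of_smooth_on _ 0 SX 1%nat y). }
  assert (Eb : forall y, ex_derive beta y).
  { intros y. exact (smooth1_of_smooth_on _ 0 Sbeta 1%nat y). }
  exists (fun y => X y * beta y), beta, (fun z => V (phi (fst z), snd z)).
  split; [| split; [| split; [| split]]].
  - apply (smooth1_of_smooth_on (fun w => X (fst w) * beta (fst w)) 0).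
    apply smooth_on_mult; auto. apply open_true.
  - exact (smooth1_of_smooth_on _ 0 Sbeta).
  (* With [alpha = X * beta] the determinant is [X' * beta^2]. *)
  - intros y. rewrite Derive_mult by auto.
    replace (_ - _) with (Derive X y * (beta y * beta y)) by ring.
    apply Rmult_integral_contrapositive. split; [apply DX |].
    apply Rmult_integral_contrapositive. split; apply Hbeta.
  - apply (open_comp (fun z : R * R => (phi (fst z), snd z)) V); auto. intros z _.
    apply (continuous_pair (fun z : R * R => phi (fst z)) snd); [| apply continuous_snd].
    apply (continuous_comp fst phi); [apply continuous_fst |].
    apply (@ex_derive_continuous R_AbsRing R_NormedModule), Dphi.
  - assert (Hmodel : forall z y, O z -> x z = x (phi y, t0) -> n z = n (phi y, t0) ->
      model_surface (fun y => X y * beta y) beta y (v z) = g z).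
    { intros z y Hz Ex En. destruct (HOU z Hz) as [[Hz1 Hz2] _].
      apply null_vector_model; auto.
      - unfold X. now rewrite <- Ex.
      - unfold beta. now rewrite <- En. }
    intros u. split.
    + intros (z & Hz & <-). destruct (Hfwd z Hz) as (s & Hs & Ex & En).
      destruct (squeeze_onto s0 a s Ha (Hva _ _ Hs)) as [y Hy]. subst s.
      exists y, (v z). split; [exact Hs | now apply Hmodel].
    + intros (y & t & Hs & <-). simpl in Hs.
      destruct (Hbwd _ _ Hs) as (z & Hz & Ev & Ex & En).
      exists z. split; [exact Hz |]. rewrite <- Ev. symmetry. now apply Hmodel.
Qed.
End Model.

Lemma vpd_swap k g z :
  vpd k (fun w => g (snd w, fst w)) z = vpd (negb k) g (snd z, fst z).
Proof. now destruct k. Qed.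

Lemma open_swap (O : R * R -> Prop) : open O -> open (fun w : R * R => O (snd w, fst w)).
Proof.
  intros HO. apply (open_comp (fun w : R * R => (snd w, fst w)) O); auto. intros z _.
  apply (continuous_pair snd fst); [apply continuous_snd | apply continuous_fst].
Qed.

(** If transversality is known only for the second partial derivative, the two variables are
    exchanged. *)
Lemma local_model_exists (U : R * R -> Prop) (g : R * R -> C2) (z0 : R * R) (r : R) :
  open U -> smooth_C2_on U g -> U z0 -> 0 < r -> g z0 = ((r, 0), (- r, 0)) ->
  (forall z, U z -> metric (g z) (g z) = 0) ->
  (forall z, U z -> exists x1 x2 : R,
    J (g z) = plus (rscal x1 (vpd true g z)) (rscal x2 (vpd false g z))) ->
  (exists k, metric (vpd k g z0) (J (g z0)) <> 0) ->
  exists O : R * R -> Prop, open O /\ O z0 /\ (forall z, O z -> U z) /\ locally_model O g.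
Proof.
  intros HU Sg U0 Hr g0 Hnull Hpos [k Hk]. destruct z0 as [s0 t0]. destruct k.
  - now apply (local_model U HU g Sg s0 t0 r).
  - destruct (local_model (fun w => U (snd w, fst w)) (open_swap U HU)
      (fun w => g (snd w, fst w))) with (s0 := t0) (t0 := s0) (r := r)
      as (O & HO & O0 & HOU & (alpha & beta & V & H1 & H2 & H3 & H4 & H5)); auto.
    + apply smooth_C2_proj. intros i j. apply smooth_C2_proj with (i := i) (j := j) in Sg.
      exact (smooth_on_swap U _ Sg).
    + intros z Hz. destruct (Hpos _ Hz) as (x1 & x2 & E). exists x2, x1.
      rewrite !vpd_swap. rewrite plus_comm. exact E.
    + exists (fun w => O (snd w, fst w)).
      split; [now apply open_swap | split; [exact O0 | split]].
      * intros [s t] Hz. exact (HOU _ Hz).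
      * exists alpha, beta, V. repeat (split; [assumption |]).
        intros u. rewrite <- H5.
        split; intros ([s t] & Hz & E); exists (t, s); (split; [exact Hz | exact E]).
Qed.

(** * Holomorphic isometries *)

Definition rot (a b : C) (z : C2) : C2 := ((a * fst z)%C, (b * snd z)%C).

Definition motion (a b : C) (c z : C2) : C2 := rot a b (minus z c).

Lemma proj_rot i j a b z : proj i j (rot a b z) =
  fst (if i then a else b) * proj i j z +
  (if j then -1 else 1) * snd (if i then a else b) * proj i (negb j) z.
Proof. destruct i, j; unfold proj, rot; simpl; ring. Qed.

Lemma proj_minus i j u v : proj i j (minus u v) = proj i j u - proj i j v.
Proof. now destruct i, j. Qed.

Lemma J_rot a b z : J (rot a b z) = rot a b (J z).
Proof. unfold rot. apply C2_ext; unfold J, scal; simpl; unfold mult; simpl; ring. Qed.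

Lemma rot_comb a b x y u v :
  rot a b (plus (rscal x u) (rscal y v)) =
  plus (rscal x (rot a b u)) (rscal y (rot a b v)).
Proof.
  apply proj_ext. intros i j.
  rewrite proj_rot, !proj_plus, !proj_rscal, !proj_rot. ring.
Qed.

Section Motion.
Context (a b : C) (Ha : fst a * fst a + snd a * snd a = 1).
Context (Hb : fst b * fst b + snd b * snd b = 1).

Lemma metric_rot u v : metric (rot a b u) (rot a b v) = metric u v.
Proof.
  rewrite !metricE. unfold rot; simpl.
  transitivity (- ((fst a * fst a + snd a * snd a) *
      (fst (fst u) * fst (fst v) + snd (fst u) * snd (fst v))) +
    (fst b * fst b + snd b * snd b) *
      (fst (snd u) * fst (snd v) + snd (snd u) * snd (snd v))); [ring |].
  rewrite Ha, Hb. ring.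
Qed.

Lemma Cmod_unit (c : C) : fst c * fst c + snd c * snd c = 1 -> Cmod c = 1.
Proof.
  intros H. unfold Cmod. rewrite <- sqrt_1. f_equal. simpl. lra.
Qed.

Lemma is_linear_rot :
  @is_linear C_AbsRing
    (prod_NormedModule C_AbsRing C_NormedModule C_NormedModule)
    (prod_NormedModule C_AbsRing C_NormedModule C_NormedModule) (rot a b).
Proof.
  split.
  - intros u v. apply C2_ext; unfold rot, plus; simpl; ring.
  - intros k u. apply C2_ext; unfold rot, scal; simpl; unfold mult; simpl; ring.
  - exists 1. split; [lra |]. intros u. rewrite Rmult_1_l. right.
    unfold norm; simpl. unfold prod_norm, rot; simpl.
    unfold norm; simpl. rewrite !Cmod_mult, (Cmod_unit a Ha), (Cmod_unit b Hb), !Rmult_1_l.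
    reflexivity.
Qed.

Lemma motion_isometry c : holomorphic_isometry (motion a b c).
Proof.
  split.
  - exists (fun z => plus (rot (Cconj a) (Cconj b) z) c).
    assert (R1 : forall z, rot (Cconj a) (Cconj b) (rot a b z) = z).
    { intros z. apply proj_ext. intros i j. rewrite !proj_rot.
      transitivity ((if i then fst a * fst a + snd a * snd a else
        fst b * fst b + snd b * snd b) * proj i j z); [destruct i, j; simpl; ring |].
      destruct i; rewrite ?Ha, ?Hb; ring. }
    assert (R2 : forall z, rot a b (rot (Cconj a) (Cconj b) z) = z).
    { intros z. rewrite <- (R1 z) at 2. apply proj_ext. intros i j. rewrite !proj_rot.
      destruct i, j; simpl; ring. }
    split; intros z; unfold motion.
    + rewrite R1. c2_ring.
    + replace (minus (plus _ c) c) with (rot (Cconj a) (Cconj b) z); [apply R2 |].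
      apply proj_ext. intros i j. rewrite proj_minus, proj_plus. ring.
  - intros z. exists (rot a b). split; [| apply metric_rot].
    (* The motion is [rot a b] plus the constant [rot a b (opp c)]; the [zero] is the differential
       of that constant. *)
    apply (filterdiff_ext_lin _ (fun u => plus (rot a b u) zero)).
    + apply (filterdiff_ext (fun u => plus (rot a b u) (rot a b (opp c)))).
      * intros u. apply proj_ext. intros i j. unfold motion, minus.
        change (proj i j (plus (rot a b u) (rot a b (opp c))) =
          proj i j (rot a b (plus u (opp c)))).
        rewrite proj_plus, !proj_rot, !proj_plus. ring.
      * apply (@filterdiff_plus_fct C_AbsRing
          (prod_NormedModule C_AbsRing C_NormedModule C_NormedModule)
          (prod_NormedModule C_AbsRing C_NormedModule C_NormedModule)
          (locally z) _ (rot a b) (fun _ => rot a b (opp c)) (rot a b) (fun _ => zero)).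
        -- apply filterdiff_linear, is_linear_rot.
        -- apply filterdiff_const.
    + intros u. apply plus_zero_r.
Qed.
End Motion.

Lemma vpd_motion U a b c G k z : open U -> smooth_C2_on U G -> U z ->
  vpd k (fun z => motion a b c (G z)) z = rot a b (vpd k G z).
Proof.
  intros HU SG Hz. rewrite smooth_C2_proj in SG.
  apply proj_ext. intros i j. rewrite proj_vpd, proj_rot, !proj_vpd.
  set (l := fst (if i then a else b)).
  set (m := (if j then -1 else 1) * snd (if i then a else b)).
  set (q := - (l * proj i j c + m * proj i (negb j) c)).
  transitivity (pd k (fun z => (l * proj i j (G z) + m * proj i (negb j) (G z)) + q) z).
  - apply (pd_ext U); auto. intros w _. unfold motion. rewrite proj_rot, !proj_minus.
    fold l m. unfold q. ring.
  - rewrite (pd_plus_on U k z Hz (fun z => l * proj i j (G z) + m * proj i (negb j) (G z))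
      (fun _ => q)).
    + rewrite pd_const, Rplus_0_r.
      rewrite (pd_plus_on U k z Hz (fun z => l * proj i j (G z))
        (fun z => m * proj i (negb j) (G z))).
      * now rewrite !pd_scal.
      * apply smooth_on_mult; auto using smooth_on_const.
      * apply smooth_on_mult; auto using smooth_on_const.
    + apply smooth_on_plus; auto; apply smooth_on_mult; auto using smooth_on_const.
    + apply smooth_on_const.
Qed.

Lemma smooth_motion U a b c G : open U -> smooth_C2_on U G ->
  smooth_C2_on U (fun z => motion a b c (G z)).
Proof.
  intros HU. rewrite !smooth_C2_proj. intros SG i j.
  apply (smooth_on_ext U (fun z => fst (if i then a else b) * (proj i j (G z) - proj i j c) +
    (if j then -1 else 1) * snd (if i then a else b) *
    (proj i (negb j) (G z) - proj i (negb j) c))); auto.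
  - intros w _. unfold motion. now rewrite proj_rot, !proj_minus.
  - apply smooth_on_plus; auto; apply smooth_on_mult; auto using smooth_on_const;
      apply smooth_on_minus; auto using smooth_on_const.
Qed.

(** Nullity gives both components the same modulus [r], so opposite phases rotate them to [r] and
    [- r]. The result is a positive multiple of [w2], which puts the base point at [x = 0] and
    argument [0]. *)
Lemma null_vector_rotation (u : C2) : metric u u = 0 -> u <> zero ->
  exists (a b : C) (r : R),
    fst a * fst a + snd a * snd a = 1 /\ fst b * fst b + snd b * snd b = 1 /\
    0 < r /\ rot a b u = ((r, 0), (- r, 0)).
Proof.
  destruct u as [[u1 u2] [u3 u4]]. rewrite metricE; simpl. intros Hn Hu.
  set (m := u1 * u1 + u2 * u2).
  assert (Hm : 0 < m).
  { unfold m. destruct (Req_dec u1 0) as [-> | H1], (Req_dec u2 0) as [-> | H2]; try nra.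
    exfalso. apply Hu. assert (u3 = 0 /\ u4 = 0) as [-> ->] by (split; nra). reflexivity. }
  set (r := sqrt m). assert (Hr : 0 < r) by now apply sqrt_lt_R0.
  assert (Hrr : r * r = m) by (apply sqrt_sqrt; lra).
  exists (u1 / r, - u2 / r), (- u3 / r, u4 / r), r. simpl.
  assert (E1 : u1 * u1 + u2 * u2 = r * r) by (rewrite Hrr; reflexivity).
  assert (E2 : u3 * u3 + u4 * u4 = r * r) by (rewrite Hrr; unfold m; lra).
  split; [| split; [| split; [exact Hr |]]].
  - transitivity ((u1 * u1 + u2 * u2) / (r * r)); [field; lra | rewrite E1; field; lra].
  - transitivity ((u3 * u3 + u4 * u4) / (r * r)); [field; lra | rewrite E2; field; lra].
  - apply C2_ext; unfold rot; simpl.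
    + transitivity ((u1 * u1 + u2 * u2) / r); [field; lra | rewrite E1; field; lra].
    + field; lra.
    + transitivity (- (u3 * u3 + u4 * u4) / r); [field; lra | rewrite E2; field; lra].
    + field; lra.
Qed.

(** * Passage from a chart to the surface *)

Lemma chart_open (M : surface) (i : index M) (O : R * R -> Prop) :
  open O -> (forall z, O z -> dom M i z) ->
  open_in M (fun q => exists z, O z /\ par M i z = q).
Proof.
  intros HO HOD j. destruct (transition_smooth M j i) as (tau & T1 & T2 & T3).
  apply (open_ext (fun z => overlap (dom M) (par M) j i z /\ O (tau z))).
  - intros z. split.
    + intros [Hz Ho]. split; [apply Hz |]. exists (tau z). split; [exact Ho | now apply T3].
    + intros [Hz (w & Hw & E)].
      assert (Hov : overlap (dom M) (par M) j i z) by (split; [exact Hz | exists w; auto]).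
      split; [exact Hov |]. destruct (T3 z Hov) as [H1 H2].
      replace (tau z) with w; [exact Hw |].
      apply (par_inj M i); auto. now rewrite H2.
  - apply (open_preimage (overlap (dom M) (par M) j i) tau); auto; [apply overlap_open |].
    intros z Hz. apply (continuous_ext (fun z => (fst (tau z), snd (tau z)))).
    + intros w. now destruct (tau w).
    + apply (continuous_pair (fun z => fst (tau z)) (fun z => snd (tau z))).
      * exact (smooth_on_continuous _ _ z T1 Hz).
      * exact (smooth_on_continuous _ _ z T2 Hz).
Qed.

Theorem theorem5p4 :
  forall (M : surface) (F : M -> C2) (h : M -> C2 -> C2 -> C2),
    smooth_immersion F ->
    lorentzian F ->
    lagrangian F ->
    second_fundamental_form F h ->
    proper_lightlike_isotropic F h ->
    type1 F h ->
    forall p : M,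
    exists W : M -> Prop,
      open_in M W /\ W p /\
      exists (Phi : C2 -> C2) (alpha beta : R -> R) (V : R * R -> Prop),
        holomorphic_isometry Phi /\
        smooth1 alpha /\ smooth1 beta /\
        (forall x : R,
           Derive alpha x * beta x - alpha x * Derive beta x <> 0) /\
        open V /\
        (forall z : C2,
           (exists q : M, W q /\ Phi (F q) = z) <->
           (exists x v : R, V (x, v) /\ model_surface alpha beta x v = z)).
Proof.
  intros M F h immersed lor lag sff isotropic typ p.
  destruct (par_cover M p) as (i & z0 & D0 & Hp).
  set (G := local_map F i).
  destruct (center_exists immersed lor lag sff isotropic typ i z0 D0)
    as (U & c & HU & U0 & HUD & Hc).
  fold G in Hc.
  assert (Gram := gram_neq_0 immersed lor lag i z0 D0). fold G in Gram.
  assert (SG : smooth_C2_on U G).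
  { apply smooth_C2_proj. intros i' j'. apply (smooth_on_sub (dom M i)); auto.
    apply smooth_C2_proj. apply immersed. }
  destruct (Hc z0 U0) as (x0 & Nx & E0 & Q0).
  assert (Hcomb : forall x y : R,
    (forall k, metric (plus (rscal x (vpd true G z0)) (rscal y (vpd false G z0)))
      (vpd k G z0) = 0) -> x = 0 /\ y = 0).
  { intros x y H. now apply (comb_eq_0 (vpd true G z0) (vpd false G z0)). }
  (* [J (G - c)] is tangent with nonzero coordinates [x0], so in a nondegenerate plane it cannot be
     orthogonal to both partial derivatives. *)
  assert (N0 : exists k, metric (vpd k G z0) (J (minus (G z0) c)) <> 0).
  { destruct (Req_dec (metric (vpd true G z0) (J (minus (G z0) c))) 0) as [H1 |];
      [| now exists true].
    exists false. intros H2. apply Nx. destruct x0 as [y1 y2].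
    destruct (Hcomb y1 y2) as [-> ->]; [| reflexivity].
    intros k. rewrite metric_sym.
    transitivity (metric (vpd k G z0) (J (minus (G z0) c))); [now rewrite E0 |].
    now destruct k. }
  assert (Z0 : minus (G z0) c <> zero).
  { intros E. destruct N0 as [k Hk]. apply Hk. rewrite E, metricE. simpl. ring. }
  destruct (null_vector_rotation _ Q0 Z0) as (a & b & r & Ha & Hb & Hr & Er).
  destruct (local_model_exists U (fun z => motion a b c (G z)) z0 r)
    as (O & HO & O0 & HOU & (alpha & beta & V & A1 & A2 & A3 & A4 & A5)); auto.
  - now apply smooth_motion.
  - intros z Hz. unfold motion. rewrite metric_rot by auto.
    now destruct (Hc z Hz) as (_ & _ & _ & Q).
  - intros z Hz. destruct (Hc z Hz) as (x & _ & E & _). exists (fst x), (snd x).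
    rewrite !(vpd_motion U) by auto. unfold motion. now rewrite J_rot, E, rot_comb.
  - destruct N0 as [k Hk]. exists k. rewrite (vpd_motion U) by auto.
    unfold motion. now rewrite J_rot, metric_rot.
  - exists (fun q => exists z, O z /\ par M i z = q).
    split; [apply chart_open; auto | split; [now exists z0 |]].
    exists (motion a b c), alpha, beta, V.
    split; [now apply motion_isometry |].
    repeat (split; [assumption |]). intros u. rewrite <- A5. split.
    + intros (q & (z & Hz & <-) & E). now exists z.
    + intros (z & Hz & E). exists (par M i z). split; [now exists z | exact E].
Qed.
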